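(* Let $V$ be a graded vector space regarded as a formal graded manifold, and let $\Gamma=\sum_{k\ge0}{}_k\Gamma\,\hslash^k\in\mathfrak g_V$, i.e. $\Gamma\in\wedge^\bullet\mathcal T_V[[\hslash]]$ with ${}_k\Gamma\in\wedge^{\bullet\ge k+1}\mathcal T_V$ for all $k$. The associated brackets ${}_kL_n:\mathcal O_V^{\otimes n}\to\mathcal O_V$, $n\ge1$, $1\le k\le n$, satisfy the graded Leibniz property in each argument, i.e. for all $1\le j\le n$ and homogeneous $f_i,g,h\in\mathcal O_V$, $${}_kL_n(f_1,\dots,f_{j-1},gh,f_{j+1},\dots,f_n)=(-1)^{|g|(|{}_kL_n|+|f_1|+\dots+|f_{j-1}|)}\,g\;{}_kL_n(f_1,\dots,h,\dots,f_n)+(-1)^{|h|(|f_{j+1}|+\dots+|f_n|)}\;{}_kL_n(f_1,\dots,g,\dots,f_n)\,h,$$ where $h$, respectively $g$, stands in the $j$-th argument on the right (for inhomogeneous $\Gamma$ the identity is understood for each homogeneous component of ${}_kL_n$). Moreover, the family $\{{}_kL_n\}_{n\ge1,\,1\le k\le n}$ gives $\mathcal O_V$ the structure of an $L^2_\infty$ algebra if and only if $\Gamma$ is of degree two and satisfies $[\Gamma,\Gamma]=0$, where $[\cdot,\cdot]$ is the $\hslash$-linear extension of the odd Schouten bracket.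
   Context: $\mathbb K$ is a field of characteristic zero; Koszul sign rules apply. Let $\{e_a\}$ be a homogeneous basis of $V$ and $\{t^a\}$ the dual basis, $|t^a|=-|e_a|$. The formal graded manifold $V$ has structure sheaf $\mathcal O_V=\widehat{\odot^\bullet V^*}\cong\mathbb K[[t^a]]$. $\mathcal T_V$ is the module of derivations of $\mathcal O_V$, generated by $\partial_a=\partial/\partial t^a$; $\wedge^\bullet\mathcal T_V:=\odot^\bullet_{\mathcal O_V}(\mathcal T_V[-1])\cong\mathbb K[[t,\psi]]$ (where $W[i]_j=W_{i+j}$), with $\psi_a$ corresponding to $\partial_a$ and $|\psi_a|=1-|t^a|$; $\wedge^i\mathcal T_V$ is the part with $i$ factors $\psi$, $|\Gamma|$ is the total degree in the $t^a,\psi_a$, and $\hslash$ is a formal parameter of degree $0$. The odd Schouten bracket is $[A,B]=A\bullet B+(-1)^{|A||B|+|A|+|B|}B\bullet A$ with $A\bullet B=\sum_a\frac{\partial A}{\partial\psi_a}\frac{\partial B}{\partial t^a}$ ($\psi$-derivative from the right, $t$-derivative from the left). Brackets: write ${}_k\Gamma=\sum_{n\ge k+1}{}_k\Gamma_n$ with ${}_k\Gamma_n=\frac1{n!}\sum{}_k\Gamma^{a_1\dots a_n}(t)\psi_{a_1}\cdots\psi_{a_n}$, the coefficients having the graded symmetry of the monomials $\psi_{a_1}\cdots\psi_{a_n}$. For $1\le k\le n$ and homogeneous $f_1,\dots,f_n\in\mathcal O_V$, $${}_kL_n(f_1,\dots,f_n)=\sum(-1)^{\epsilon}\ {}_{k-1}\Gamma^{a_1\dots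 a_n}(t)(\partial_{a_1}f_1)\cdots(\partial_{a_n}f_n),\qquad \epsilon=\sum_{i=2}^n|t^{a_i}|\,(|f_1|+\dots+|f_{i-1}|+i-1).$$ $L^2_\infty$ algebra: a graded vector space $W$ with a family of graded skew symmetric maps ${}_il_n:\wedge^nW\to W$ of degree $2-n$, $n\ge1$, $1\le i\le n$ (the map ${}_1l_1$ being the differential of $W$), such that for all $n\ge1$, all $2\le k\le n+1$ and homogeneous $v_1,\dots,v_n$ $$\sum_{\substack{r+s=n+1\\ i+j=k}}\ \sum_\sigma\epsilon(\sigma)\,\mathrm{sgn}(\sigma)(-1)^{r(s-1)}\ {}_il_r\big({}_jl_s(v_{\sigma(1)},\dots,v_{\sigma(s)}),v_{\sigma(s+1)},\dots,v_{\sigma(n)}\big)=0,$$ where $1\le i\le r$, $1\le j\le s$, $\sigma$ runs over $(s,r-1)$-unshuffles, and $\epsilon(\sigma)$ is the Koszul sign of permuting $v_1,\dots,v_n$ by $\sigma$.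
   Formalization: With the stated signs the equivalence fails for n=3 (e.g. Γ=ψ_θ+ψ_xψ_y+xψ_xψ_z−θψ_xψ_yψ_z, |θ|=−1, |x|=|y|=|z|=0); the L²∞ structure is therefore asserted for the family (−1)^{n(n−1)/2} _kL_n instead of _kL_n. *)

(* Defs.v *)
From mathcomp Require Import all_boot all_order all_algebra perm.
(* [functions] supplies the pointwise lmodType structure on function types *)
From mathcomp Require Import boolp functions.

Set Implicit Arguments.
Unset Strict Implicit.
Unset Printing Implicit Defensive.

Import GRing.Theory.
Local Open Scope ring_scope.

(* Formal power series K[[x_0, ..., x_(n-1)]] in graded commuting variables of
   degrees [d i].  A series is its family of coefficients on the monomials
   x_0^(p 0) ... x_(n-1)^(p (n-1)), written in this order; variables of odd
   degree square to zero, whence the exponent bound.  All sign exponents are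
   kept in [int], as (-1) ^ z only depends on the parity of z. *)
Section GradedSeries.
Variables (K : fieldType) (n : nat) (d : 'I_n -> int).
Implicit Types (p q : {ffun 'I_n -> nat}) (i j : 'I_n).

Definition admissible p := [forall i, odd `|d i|%N ==> (p i <= 1)%N].

Definition monomial := {p : {ffun 'I_n -> nat} | admissible p}.

Definition series := monomial -> K^o.

Implicit Types (f g : series) (m : monomial).

(* total coefficient function, zero on inadmissible exponents *)
Definition coef f p : K := if insub p is Some m then f m else 0.

Definition expdeg p : int := \sum_(i < n) (p i)%:Z * d i.

Definition homogeneous (e : int) f : Prop :=
  forall m, f m != 0 -> expdeg (val m) = e.

Definition hcomp (e : int) f : series :=
  fun m => if expdeg (val m) == e then f m else 0.

Definition parity_part (b : bool) f : series :=
  fun m => if odd `|expdeg (val m)|%N == b then f m else 0.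

Definition sone : series := fun m => (val m == [ffun=> 0%N])%:R.

Definition gen i : series := fun m => (val m == [ffun j => (j == i) : nat])%:R.

(* x^p * x^q = (-1)^(merge_exponent p q) x^(p + q): each x_j of the right
   factor moves left past the x_i with j < i of the left factor *)
Definition merge_exponent p q : int :=
  \sum_(i < n) \sum_(j < n | (j < i)%N) (p i)%:Z * (q j)%:Z * (d i * d j).

(* the sum is over all p <= m *)
Definition smul f g : series := fun m =>
  \sum_(s : {dffun forall i : 'I_n, 'I_(val m i).+1})
    let p := [ffun i => nat_of_ord (s i)] in
    let q := [ffun i => (val m i - s i)%N] in
    (-1) ^ merge_exponent p q * (coef f p * coef g q).

Definition incr_exp p i : {ffun 'I_n -> nat} := [ffun j => (p j + (j == i))%N].

(* the partial derivatives acting from the left and from the right, i.e. the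
   derivations with x_j |-> (j == i), moved to x_i past the variables standing
   before it, respectively after it *)
Definition lder i f : series := fun m =>
  (-1) ^ (d i * \sum_(j < n | (j < i)%N) (val m j)%:Z * d j)
    * (val m i).+1%:R * coef f (incr_exp (val m) i).

Definition rder i f : series := fun m =>
  (-1) ^ (d i * \sum_(j < n | (i < j)%N) (val m j)%:Z * d j)
    * (val m i).+1%:R * coef f (incr_exp (val m) i).

End GradedSeries.

Arguments sone K {n} d.
Arguments gen K {n} d i.

(* L^2_oo algebras.  The graded vector space is given by a K-module [W] and its
   homogeneous elements: [hom e] is the subspace of elements of degree e.  The
   operation _k l_n is [l k] on lists of length n; only 1 <= k <= n matters. *)
Section L2infinity.
Variables (K : fieldType) (W : lmodType K) (hom : int -> W -> Prop).

Definition homs (ds : seq int) (vs : seq W) : Prop :=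
  size ds = size vs /\
  forall i, (i < size vs)%N -> hom (nth 0 ds i) (nth 0 vs i).

Definition unshuffle n (s : nat) (sigma : 'S_n) : bool :=
  [forall i : 'I_n, forall j : 'I_n,
     ((i < j)%N && ((j < s)%N || (s <= i)%N)) ==> (sigma i < sigma j)%N].

Definition koszul_sign n (dv : 'I_n -> int) (sigma : 'S_n) : K :=
  \prod_(i < n) \prod_(j < n | (i < j)%N && (sigma j < sigma i)%N)
    (-1) ^ (dv (sigma i) * dv (sigma j)).

Definition L2_relation (l : nat -> seq W -> W) (n k : nat) : Prop :=
  forall (dv : 'I_n -> int) (v : 'I_n -> W), (forall i, hom (dv i) (v i)) ->
  \sum_(1 <= r < n.+1) \sum_(1 <= s < n.+1 | (r + s == n.+1)%N)
  \sum_(1 <= i < r.+1) \sum_(1 <= j < s.+1 | (i + j == k)%N)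
  \sum_(sigma : 'S_n | unshuffle s sigma)
    (let w := [seq v (sigma x) | x <- enum 'I_n] in
    (koszul_sign dv sigma * (-1) ^+ sigma * (-1) ^+ (r * (s - 1)))
      *: l i (l j (take s w) :: drop s w)) = 0.

Record is_L2infty (l : nat -> seq W -> W) : Prop := IsL2infty {
  L2_multilinear : forall (k : nat) (us vs : seq W) (c : K) (x y : W),
    (1 <= k <= (size us + size vs).+1)%N ->
    l k (us ++ (c *: x + y) :: vs) =
      c *: l k (us ++ x :: vs) + l k (us ++ y :: vs);
  L2_degree : forall (k : nat) (ds : seq int) (vs : seq W),
    (1 <= k <= size vs)%N -> homs ds vs ->
    hom (\sum_(e <- ds) e + 2 - (size vs)%:Z) (l k vs);
  L2_skew : forall (k : nat) (ds es : seq int) (dx dy : int)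
      (us vs : seq W) (x y : W),
    (1 <= k <= (size us + size vs).+2)%N ->
    homs ds us -> homs es vs -> hom dx x -> hom dy y ->
    l k (us ++ x :: y :: vs) = (- (-1) ^ (dx * dy)) *: l k (us ++ y :: x :: vs);
  L2_jacobi : forall n k : nat,
    (1 <= n)%N -> (2 <= k <= n.+1)%N -> L2_relation l n k
}.

End L2infinity.

(* V is the graded vector space with homogeneous basis e_a (a : 'I_m),
   |e_a| = [edeg a]. *)
Section FormalManifold.
Variables (K : fieldType) (m : nat) (edeg : 'I_m -> int).

Definition tdeg (a : 'I_m) : int := - edeg a.
Definition psideg (a : 'I_m) : int := 1 - tdeg a.

(* O_V = K[[t]] *)
Definition functionsV := series K tdeg.

(* the polyvector fields K[[t, psi]], t^a being the variable [lshift m a] and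
   psi_a the variable [rshift m a] *)
Definition tpsideg (i : 'I_(m + m)) : int :=
  match fintype.split i with inl a => tdeg a | inr a => psideg a end.
Definition polyvec := series K tpsideg.


Implicit Types (A B : polyvec) (f g h : functionsV).

Definition psi (a : 'I_m) : polyvec := gen K tpsideg (rshift m a).

Definition psi_weight (p : {ffun 'I_(m + m) -> nat}) : nat :=
  \sum_(a < m) p (rshift m a).

Definition weight_part (w : nat) A : polyvec :=
  fun p => if psi_weight (val p) == w then A p else 0.

Definition weight_ge (w : nat) A : Prop :=
  forall p, A p != 0 -> (w <= psi_weight (val p))%N.

(* the inclusion K[[t]] -> K[[t, psi]] *)
Definition embed f : polyvec := fun p =>
  if psi_weight (val p) == 0%N
  then coef f [ffun a => val p (lshift m a)] else 0.

Definition bullet A B : polyvec :=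
  \sum_(a < m) smul (rder (rshift m a) A) (lder (lshift m a) B).

(* bilinear extension to inhomogeneous arguments of
   A . B + (-1)^(|A||B| + |A| + |B|) B . A, whose sign only involves the
   parities x of |A| and y of |B| *)
Definition schouten A B : polyvec :=
  bullet A B +
  \sum_(x : bool) \sum_(y : bool)
    (-1) ^+ (x * y + x + y) *: bullet (parity_part y B) (parity_part x A).

(* series in hbar are sequences of coefficients *)
Definition hschouten (A B : nat -> polyvec) (k : nat) : polyvec :=
  \sum_(i < k.+1) schouten (A i) (B (k - i)%N).

(* [G [:: a_1; ...; a_n]] is the coefficient A^(a_1 ... a_n)(t) in
   A_n = 1/n! \sum A^(a_1 ... a_n)(t) psi_(a_1) ... psi_(a_n) *)
Definition coefficients_of A (G : seq 'I_m -> functionsV) : Prop :=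
  (forall (u v : seq 'I_m) (a b : 'I_m),
     G (u ++ a :: b :: v) =
       ((-1) ^ (psideg a * psideg b) : K) *: G (u ++ b :: a :: v)) /\
  (forall n : nat,
     weight_part n A =
       (n`!%:R : K)^-1 *:
         \sum_(a : n.-tuple 'I_m)
           foldl (fun B c => smul B (psi c)) (embed (G a)) a).

Definition bracket_exponent n (a : n.-tuple 'I_m) (ds : seq int) : int :=
  \sum_(i < n) tdeg (tnth a i) * (\sum_(e <- take i ds) e + i%:Z).

(* the bracket with coefficients G, for arguments whose degrees have the
   parities of [ds] *)
Definition hom_bracket (G : seq 'I_m -> functionsV)
    (ds : seq int) (fs : seq functionsV) : functionsV :=
  \sum_(a : (size fs).-tuple 'I_m)
    ((-1) ^ bracket_exponent a ds : K) *:
      smul (G a)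
        (foldr (fun af x => smul (lder af.1 af.2) x) (sone K tdeg) (zip a fs)).

(* its multilinear extension to arbitrary arguments, split into their even and
   odd parts *)
Definition bracket (G : seq 'I_m -> functionsV) (fs : seq functionsV) :
    functionsV :=
  \sum_(b : (size fs).-tuple bool)
    hom_bracket G [seq (nat_of_bool x)%:Z | x <- b]
      [seq parity_part xf.1 xf.2 | xf <- zip b fs].

(* _k L_n is [Lbr G k] on lists of length n, G i being the coefficients of the
   hbar^i-component of Gamma.  For Gamma of degree two, [Gamma, Gamma] = 0 amounts
   to the relations \sum (-1)^r L_r (L_s (...), ...) = 0.  The sign
   (-1)^(r (s - 1)) of [L2_relation] is the one for the operations
   (-1)^(n (n - 1) / 2) L_n, not for the L_n themselves. *)
Definition Lbr (G : nat -> seq 'I_m -> functionsV) (k : nat) :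
    seq functionsV -> functionsV := bracket (G k.-1).

(* value on arguments of degrees [ds] of the component of degree [e] of the
   multilinear map [L] *)
Definition map_comp (L : seq functionsV -> functionsV)
    (e : int) (ds : seq int) (fs : seq functionsV) : functionsV :=
  hcomp (\sum_(x <- ds) x + e) (L fs).

Definition graded_leibniz (L : seq functionsV -> functionsV) (n : nat) : Prop :=
  forall (e dg dh : int) (ds es : seq int) (us vs : seq functionsV) g h,
    (size us + size vs).+1 = n ->
    homs (@homogeneous K m tdeg) ds us -> homs (@homogeneous K m tdeg) es vs ->
    homogeneous dg g -> homogeneous dh h ->
    map_comp L e (ds ++ (dg + dh) :: es) (us ++ smul g h :: vs) =
      ((-1) ^ (dg * (e + \sum_(x <- ds) x)) : K) *:
        smul g (map_comp L e (ds ++ dh :: es) (us ++ h :: vs))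
      + ((-1) ^ (dh * \sum_(x <- es) x) : K) *:
        smul (map_comp L e (ds ++ dg :: es) (us ++ g :: vs)) h.

End FormalManifold.

(* Main.v *)
(* Write X_f A for A . f, f a function.  With the coefficients of A recovered as
   the restrictions to psi = 0 of iterated right psi-derivatives of A, the bracket
   L(f_1, ..., f_n) is, up to a sign depending only on the degrees of the f_i,
   the restriction to psi = 0 of X_(f_1) ... X_(f_n) A.  Since X_f is a
   derivation in f, and X_f and X_g commute up to sign, this gives the Leibniz
   rule and the skew symmetry.  On functions . vanishes, so X_f is a derivation
   of the Schouten bracket; hence X_(f_1) ... X_(f_n) [Gamma, Gamma] is a sum over
   the ways of distributing the f_i over the two copies of Gamma, and its
   restriction to psi = 0 is twice the left hand side of the n-th L_oo relation.
   So [Gamma, Gamma] = 0 implies the relations; conversely, for f_i = t^(a_i)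
   these restrictions are the coefficients of [Gamma, Gamma]. *)
Require Import Defs.
From mathcomp Require Import all_boot all_order all_algebra perm.
From mathcomp Require Import boolp functions.
From mathcomp Require Import zify ring.

Set Implicit Arguments.
Unset Strict Implicit.
Unset Printing Implicit Defensive.

Import GRing.Theory.
Local Open Scope ring_scope.

(** * Graded power series *)

(** The obstacles are signs, infinite sums and index ranges. A sign is kept as a boolean, the parity
    of its exponent, so that once the operators stand in a normal form a sign identity is a
    propositional tautology settled by cases. An identity of series is tested on monomials, which
    suffices by linearity and continuity. To match a relation with X_(f_1) ... X_(f_n)
    [Gamma, Gamma], all its terms must differ from the terms of the latter by one common sign; the
    rescaling of L_n by (-1)^(n (n - 1) / 2) achieves this. The powers of hbar match because the
    coefficient of hbar^k in Gamma has at least k + 1 factors psi: a term whose level exceeds its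
    arity keeps a psi and dies at psi = 0, so the restricted sums over levels are full convolutions.
    In the converse, degree two has to be proved before [Gamma, Gamma] = 0, since the sign
    computations need Gamma even; it comes from the degrees of the brackets of coordinates.
    Characteristic zero enters through n!, through the exponents produced by differentiation and
    through the factor 2. *)

Definition par (z : int) : bool := odd `|z|%N.

Lemma parD x y : par (x + y) = par x (+) par y.
Proof. rewrite /par; lia. Qed.

Lemma parN x : par (- x) = par x.
Proof. by rewrite /par abszN. Qed.

Lemma parM x y : par (x * y) = par x && par y.
Proof. by rewrite /par abszM oddM. Qed.

Lemma par_nat k : par k%:Z = odd k.
Proof. by []. Qed.

Definition parE := (parD, parN, parM, par_nat).

Lemma sgz_par (R : unitRingType) (z : int) : (-1 : R) ^ z = (-1) ^+ par z.
Proof.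
case: z => k; first by rewrite /par /exprz /= signr_odd.
by rewrite /par /exprz -[in LHS]signr_odd invr_sign.
Qed.

Lemma par_sum (I : Type) (r : seq I) (P : pred I) (F : I -> int) :
  par (\sum_(i <- r | P i) F i) = \big[addb/false]_(i <- r | P i) par (F i).
Proof. exact: (big_morph par parD). Qed.

Section Series.
Variables (K : fieldType) (n : nat) (d : 'I_n -> int).
Implicit Types (p q r : {ffun 'I_n -> nat}) (i j : 'I_n).
Implicit Types (f g h : series K d).

Definition madd p q : {ffun 'I_n -> nat} := [ffun i => (p i + q i)%N].
Definition mpred p i : {ffun 'I_n -> nat} := [ffun j => (p j - (j == i))%N].
Definition total_exp p : nat := (\sum_i p i)%N.

(** For inadmissible [p] this is the zero series, as it should be when an odd variable is squared;
    hence [smul_mono] needs no side condition. *)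
Definition mono p : series K d := fun m => (val m == p)%:R.

Lemma serE f g : (forall m, f m = g m) -> f = g.
Proof. by move=> H; apply/funext. Qed.

Lemma addsE f g m : (f + g) m = f m + g m. Proof. by []. Qed.
Lemma oppsE f m : (- f) m = - f m. Proof. by []. Qed.
Lemma scalesE (c : K) f m : (c *: f) m = c * f m. Proof. by []. Qed.
Lemma zerosE m : (0 : series K d) m = 0. Proof. by []. Qed.
Lemma sumsE (I : Type) (s : seq I) (P : pred I) (F : I -> series K d) m :
  (\sum_(x <- s | P x) F x) m = \sum_(x <- s | P x) F x m.
Proof. by rewrite fct_sumE. Qed.

Lemma coef_val f (m : monomial d) : coef f (val m) = f m.
Proof. by rewrite /coef valK. Qed.

Lemma coef_inadm f p : ~~ admissible d p -> coef f p = 0.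
Proof. by move=> H; rewrite /coef insubN. Qed.

Lemma coef_linear c f g p : coef (c *: f + g) p = c * coef f p + coef g p.
Proof. by rewrite /coef; case: insubP => //= _; rewrite mulr0 addr0. Qed.

Lemma coef_mono p q : coef (mono p) q = ((q == p) && admissible d p)%:R.
Proof.
rewrite /coef; case: insubP => [m ha hv|ha].
  by rewrite /mono hv; case: eqP => // <-; rewrite ha.
by case: eqP => //= <-; rewrite (negbTE ha).
Qed.

Lemma mono0 p : ~~ admissible d p -> mono p = 0.
Proof.
move=> ha; apply: serE => m; rewrite /mono; case: eqP => // e.
by move: ha; rewrite -e (valP m).
Qed.

Lemma admissible_le p q : (forall i, p i <= q i)%N ->
  admissible d q -> admissible d p.
Proof.
move=> le /forallP H; apply/forallP => i; apply/implyP => o.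
by apply: leq_trans (le i) _; move: (H i); rewrite o.
Qed.

Lemma admissible_pred p i : admissible d p -> admissible d (mpred p i).
Proof. by apply: admissible_le => j; rewrite ffunE leq_subr. Qed.

Definition below p i : int := \sum_(j < n | (j < i)%N) (p j)%:Z * d j.
Definition above p i : int := \sum_(j < n | (i < j)%N) (p j)%:Z * d j.

Lemma expdeg_split p i : expdeg d p = below p i + (p i)%:Z * d i + above p i.
Proof.
rewrite /expdeg (bigD1 i) //= (bigID (fun j : 'I_n => (j < i)%N)) /=.
rewrite addrA [_ * _ + _]addrC; congr (_ + _ + _).
  apply: eq_bigl => j; rewrite andbC -(inj_eq val_inj) /=; lia.
apply: eq_bigl => j; rewrite -(inj_eq val_inj) /=; lia.
Qed.

Lemma expdegD p q : expdeg d (madd p q) = expdeg d p + expdeg d q.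
Proof.
by rewrite -big_split; apply: eq_bigr => i _; rewrite ffunE PoszD mulrDl.
Qed.

Lemma below_add p q i : below (madd p q) i = below p i + below q i.
Proof.
by rewrite -big_split; apply: eq_bigr => j _; rewrite ffunE PoszD mulrDl.
Qed.

(** Grouping the exponent by the left factor, here, or by the right factor, in [merge_above], makes
    additivity in the respective argument evident. *)
Lemma merge_below p q :
  merge_exponent d p q = \sum_i (p i)%:Z * d i * below q i.
Proof.
apply: eq_bigr => i _; rewrite big_distrr /=; apply: eq_bigr => j _; ring.
Qed.

Lemma merge_above p q :
  merge_exponent d p q = \sum_i (q i)%:Z * d i * above p i.
Proof.
rewrite /merge_exponent (exchange_big_dep predT) //=.
apply: eq_bigr => i _; rewrite big_distrr /=; apply: eq_bigr => j _; ring.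
Qed.

Lemma merge_addl p q r :
  merge_exponent d (madd p q) r = merge_exponent d p r + merge_exponent d q r.
Proof.
rewrite !merge_below -big_split; apply: eq_bigr => i _ /=.
rewrite ffunE PoszD; ring.
Qed.

Lemma merge_addr p q r :
  merge_exponent d p (madd q r) = merge_exponent d p q + merge_exponent d p r.
Proof.
rewrite !merge_above -big_split; apply: eq_bigr => i _ /=.
rewrite ffunE PoszD; ring.
Qed.

Definition munit i : {ffun 'I_n -> nat} := [ffun j => (j == i) : nat].

Lemma mpredK p i : (0 < p i)%N -> p = madd (mpred p i) (munit i).
Proof.
by move=> h; apply/ffunP => j; rewrite !ffunE; case: eqP => [->|] /=; lia.
Qed.

Lemma merge_unitl i q : merge_exponent d (munit i) q = d i * below q i.
Proof.
rewrite merge_below (bigD1 i) //= ffunE eqxx mul1r big1 ?addr0 // => j ji.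
by rewrite ffunE (negbTE ji) !mul0r.
Qed.

Lemma merge_unitr i q : merge_exponent d q (munit i) = d i * above q i.
Proof.
rewrite merge_above (bigD1 i) //= ffunE eqxx mul1r big1 ?addr0 // => j ji.
by rewrite ffunE (negbTE ji) !mul0r.
Qed.

Lemma expdeg_unit i : expdeg d (munit i) = d i.
Proof.
rewrite /expdeg (bigD1 i) //= ffunE eqxx mul1r big1 ?addr0 // => j ji.
by rewrite ffunE (negbTE ji) !mul0r.
Qed.

Lemma below_unit i j : below (munit i) j = if (i < j)%N then d i else 0.
Proof.
rewrite /below; case: ifP => h.
  rewrite (bigD1 i) //= ffunE eqxx mul1r big1 ?addr0 // => k /andP[_ ki].
  by rewrite ffunE (negbTE ki) !mul0r.
rewrite big1 // => k hk; rewrite ffunE; case: eqP hk h => [->|_ _ _] /=.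
  by move=> ->.
by rewrite mul0r.
Qed.

(** The two reorderings together exchange every variable of x^p with every variable of x^q, except
    equal ones. The resulting diagonal term is even whenever [madd p q] is admissible, which gives
    graded commutativity. *)
Lemma merge_comm p q :
  merge_exponent d p q + merge_exponent d q p =
  expdeg d p * expdeg d q - \sum_i ((p i)%:Z * (q i)%:Z) * (d i * d i).
Proof.
rewrite merge_below merge_above -big_split /=; apply/eqP.
rewrite eq_sym subr_eq -big_split /expdeg big_distrl /=; apply/eqP.
apply: eq_bigr => i _; rewrite -/(expdeg d q) (expdeg_split q i); ring.
Qed.

Let mulP_l (s a b c e : K) : s * ((c * a + b) * e) = c * (s * (a * e)) + s * (b * e).
Proof. ring. Qed.

Let mulP_r (s a b c e : K) : s * (e * (c * a + b)) = c * (s * (e * a)) + s * (e * b).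
Proof. ring. Qed.

Lemma smul_mono p q :
  smul (mono p) (mono q) = ((-1) ^+ par (merge_exponent d p q) : K) *: mono (madd p q).
Proof.
apply: serE => m; rewrite scalesE -sgz_par /smul /mono.
case: (eqVneq (val m) (madd p q)) => [e|ne]; last first.
  rewrite mulr0 big1 // => s _; rewrite !coef_mono.
  case: eqP => [ep|]; last by rewrite !(mul0r, mulr0).
  case: eqP => [eq|]; last by rewrite !(mul0r, mulr0).
  case/eqP: ne; apply/ffunP => i; rewrite ffunE -ep -eq !ffunE.
  by rewrite subnKC // -ltnS.
(* Only the splitting of [val m] into [p] and [q] contributes to the sum. *)
pose s0 : {dffun forall i : 'I_n, 'I_(val m i).+1} := [ffun i => inord (p i)].
have le i : (p i < (val m i).+1)%N by rewrite e ffunE; lia.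
have sE i : s0 i = p i :> nat by rewrite ffunE inordK.
have s0E : [ffun i => nat_of_ord (s0 i)] = p.
  by apply/ffunP => i; rewrite ffunE sE.
have s1E : [ffun i => (val m i - s0 i)%N] = q.
  by apply/ffunP => i; rewrite ffunE sE e ffunE addKn.
have am := valP m; rewrite /= e in am.
have ap : admissible d p by apply: admissible_le am => i; rewrite ffunE leq_addr.
have aq : admissible d q by apply: admissible_le am => i; rewrite ffunE leq_addl.
rewrite (bigD1 s0) //= s0E s1E !coef_mono !eqxx ap aq /= big1 ?addr0 ?mulr1 //.
move=> s ne; rewrite !coef_mono; case: eqP => [ep|]; last by rewrite mul0r mulr0.
case/eqP: ne; apply/ffunP => i; apply: val_inj; rewrite /= sE.
by move/ffunP/(_ i): ep; rewrite ffunE.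
Qed.

Lemma smulPl c f g h : smul (c *: f + g) h = c *: smul f h + smul g h.
Proof.
apply: serE => m; rewrite addsE scalesE /smul big_distrr -big_split /=.
by apply: eq_bigr => s _; rewrite coef_linear; apply: mulP_l.
Qed.

Lemma smulPr c f g h : smul h (c *: f + g) = c *: smul h f + smul h g.
Proof.
apply: serE => m; rewrite addsE scalesE /smul big_distrr -big_split /=.
by apply: eq_bigr => s _; rewrite coef_linear; apply: mulP_r.
Qed.

Lemma lderP i c f g : lder i (c *: f + g) = c *: lder i f + lder i g.
Proof.
apply: serE => m; rewrite addsE scalesE /lder coef_linear.
by rewrite mulrDr (mulrCA c).
Qed.

Lemma rderP i c f g : rder i (c *: f + g) = c *: rder i f + rder i g.
Proof.
apply: serE => m; rewrite addsE scalesE /rder coef_linear.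
by rewrite mulrDr (mulrCA c).
Qed.

Lemma below_mpred p i : below (mpred p i) i = below p i.
Proof.
apply: eq_bigr => j ji; rewrite ffunE; case: eqP ji => [->|_ _]; last by rewrite subn0.
by rewrite ltnn.
Qed.

(** Admissibility matters: for [d i] odd and [p i] equal to 2 the series [mono p] is zero, while
    [mono (mpred p i)] may be nonzero. *)
Lemma lder_mono p i : admissible d p ->
  lder i (mono p) = ((-1) ^+ par (d i * below p i) * (p i)%:R : K) *: mono (mpred p i).
Proof.
move=> ap; apply: serE => m; rewrite scalesE /lder coef_mono ap andbT /mono sgz_par.
have [p0|p0] := posnP (p i).
  rewrite p0 mulr0 mul0r; case: eqP => [e|]; last by rewrite mulr0.
  by move: p0; rewrite -e ffunE eqxx; lia.
have -> : (incr_exp (val m) i == p) = (val m == mpred p i).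
  apply/eqP/eqP => [<-|->]; apply/ffunP => j; rewrite !ffunE ?addnK //.
  by case: eqP => [->|] /=; lia.
case: eqP => [e|]; rewrite ?mulr0 ?mulr1 //.
rewrite -/(below (val m) i) e below_mpred ffunE eqxx; congr (_ * _%:R); lia.
Qed.

(** Signs depend on parities only, and a series is a sum of two components of this kind, whereas it
    may have infinitely many components of distinct degrees. *)
Definition parhom (b : bool) f := forall m, f m != 0 -> par (expdeg d (val m)) = b.

(* Moving d_i from the left to the right of f costs d_i (|f| - d_i). *)
Lemma rder_lder b i f : parhom b f ->
  rder i f = ((-1) ^+ (par (d i) && ~~ b) : K) *: lder i f.
Proof.
move=> hf; apply: serE => m; rewrite scalesE /rder /lder !mulrA !sgz_par.
rewrite -/(below (val m) i) -/(above (val m) i).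
rewrite {1}/coef; case: insubP => [m' am' e|am']; last by rewrite coef_inadm // !mulr0.
rewrite -e coef_val; case: (eqVneq (f m') 0) => [->|nz]; first by rewrite !mulr0.
congr (_ * _ * _); rewrite -signr_addb; congr (_ ^+ _); rewrite -(hf _ nz) e.
rewrite (_ : incr_exp _ i = madd (val m) (munit i)); last first.
  by apply/ffunP => j; rewrite !ffunE.
rewrite expdegD expdeg_unit (expdeg_split _ i) !parE.
case E: (par (d i)) => //=.
move/forallP: am' => /(_ i); rewrite -/(par _) E /= ffunE eqxx addn1 ltnS leqn0.
move/eqP=> ->.
by case: (par (below _ _)); case: (par (above _ _)).
Qed.

Lemma madd_predl p q i : (0 < p i)%N -> madd (mpred p i) q = mpred (madd p q) i.
Proof.
by move=> h; apply/ffunP => j; rewrite !ffunE; case: eqP => [->|] /=; lia.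
Qed.

Lemma madd_predr p q i : (0 < q i)%N -> madd p (mpred q i) = mpred (madd p q) i.
Proof.
by move=> h; apply/ffunP => j; rewrite !ffunE; case: eqP => [->|] /=; lia.
Qed.

Lemma maddA p q r : madd p (madd q r) = madd (madd p q) r.
Proof. by apply/ffunP => i; rewrite !ffunE addnA. Qed.

Lemma maddC p q : madd p q = madd q p.
Proof. by apply/ffunP => i; rewrite !ffunE addnC. Qed.

Lemma smul0l f : smul 0 f = 0.
Proof. by move: (smulPl (-1) f f f); rewrite !scaleN1r !addNr. Qed.

Lemma smul0r f : smul f 0 = 0.
Proof. by move: (smulPr (-1) f f f); rewrite !scaleN1r !addNr. Qed.

Lemma lder0 i : lder i (0 : series K d) = 0.
Proof. by move: (lderP i (-1) 0 0); rewrite !scaleN1r !addNr. Qed.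

Lemma lderZ i c f : lder i (c *: f) = c *: lder i f.
Proof. by rewrite -[c *: f]addr0 lderP lder0 addr0. Qed.

Lemma smulZl c f g : smul (c *: f) g = c *: smul f g.
Proof. by rewrite -[c *: f]addr0 smulPl smul0l addr0. Qed.

Lemma smulZr c f g : smul f (c *: g) = c *: smul f g.
Proof. by rewrite -[c *: g]addr0 smulPr smul0r addr0. Qed.

Let sg1 (a b c e : bool) (k : K) : a (+) b = c (+) e ->
  (-1) ^+ a * ((-1) ^+ b * k) = (-1) ^+ c * k * (-1) ^+ e.
Proof. by move=> h; rewrite mulrA -signr_addb h signr_addb mulrAC. Qed.

Let sg2 (a b c e f : bool) (k : K) : a (+) b = c (+) e (+) f ->
  (-1) ^+ a * ((-1) ^+ b * k) = (-1) ^+ c * ((-1) ^+ e * k * (-1) ^+ f).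
Proof.
by move=> h; rewrite mulrA -signr_addb h !signr_addb mulrAC !mulrA.
Qed.

Lemma lder_smul_mono i p q : admissible d p -> admissible d q ->
  lder i (smul (mono p) (mono q)) =
    smul (lder i (mono p)) (mono q) +
    ((-1) ^+ (par (d i) && par (expdeg d p)) : K) *: smul (mono p) (lder i (mono q)).
Proof.
move=> ap aq; rewrite smul_mono lderZ (lder_mono i ap) (lder_mono i aq) smulZl smulZr !smul_mono.
(* For [p i] equal to 0 the truncated [mpred] gives the wrong exponent, but then the factor
   [(p i)%:R] vanishes. The same holds for [q] in [Er]. *)
have El c : (c * (p i)%:R) *: (((-1) ^+ par (merge_exponent d (mpred p i) q) : K) *:
    mono (madd (mpred p i) q)) = (c * (p i)%:R * (-1) ^+ (par (merge_exponent d p q)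
      (+) par (d i * below q i))) *: mono (mpred (madd p q) i).
  have [->|p0] := posnP (p i); first by rewrite mulr0 mul0r !scale0r.
  rewrite scalerA madd_predl //; congr (_ *: _); congr (_ * _).
  congr (_ ^+ _).
  by rewrite [in RHS](mpredK p0) merge_addl merge_unitl !parE -addbA addbb addbF.
have Er c : (c * (q i)%:R) *: (((-1) ^+ par (merge_exponent d p (mpred q i)) : K) *:
    mono (madd p (mpred q i))) = (c * (q i)%:R * (-1) ^+ (par (merge_exponent d p q)
      (+) par (d i * above p i))) *: mono (mpred (madd p q) i).
  have [->|p0] := posnP (q i); first by rewrite mulr0 mul0r !scale0r.
  rewrite scalerA madd_predr //; congr (_ *: _); congr (_ * _); congr (_ ^+ _).
  by rewrite [in RHS](mpredK p0) merge_addr merge_unitr !parE -addbA addbb addbF.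
rewrite El Er scalerA -scalerDl.
case apq: (admissible d (madd p q)).
  rewrite lder_mono // scalerA; congr (_ *: _).
  rewrite below_add ffunE natrD mulrDr mulrDr.
  congr (_ + _).
    by apply: sg1; rewrite !parE; do 4!case: (par _).
  have [->|q0] := posnP (q i); first by rewrite !(mulr0, mul0r).
  apply: sg2; rewrite (expdeg_split p i) !parE.
  case E : (par (d i)) => /=; last by rewrite !addbF.
  move/forallP: apq => /(_ i); rewrite -/(par _) E /= ffunE => h.
  have -> : (p i) = 0%N by lia.
  by do 4!case: (par _).
(* The product is zero here, but the two terms on the right may be zero only jointly: if lowering
   the exponent of x_i restores admissibility, then x_i is odd and occurs once in each factor, and
   the terms carry opposite signs. *)
rewrite mono0 ?apq // lder0 scaler0.
case ap1: (admissible d (mpred (madd p q) i)); last by rewrite mono0 ?ap1 // scaler0.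
suff [E [p1 q1]] : par (d i) /\ p i = 1%N /\ q i = 1%N.
  rewrite p1 q1 !mulr1 -!signr_addb.
  rewrite (expdeg_split p i) !parE p1 E /=.
  case: (par (below p i)) (par (above p i)) (par (merge_exponent d p q)) (par (below q i)).
    by do 3!case; rewrite /= ?expr0 ?expr1 ?addNr ?subrr scale0r.
  by do 3!case; rewrite /= ?expr0 ?expr1 ?addNr ?subrr scale0r.
case/negbT/forallPn: apq => j; rewrite negb_imply => /andP[oj hj].
move/forallP: ap1 => /(_ j); rewrite oj /=.
move/forallP: ap => /(_ j); rewrite oj /=.
move/forallP: aq => /(_ j); rewrite oj /=; move: hj.
rewrite !ffunE; case: eqP => [<-|] /=; last by lia.
by move=> h1 h2 h3 h4; split=> //; lia.
Qed.

End Series.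
Arguments mono K {n} d p.

(** * Continuous linear maps of series *)

Section Continuity.
Variable K : fieldType.

(* [clin T]: T is linear and continuous for the topology given by the total
   exponent, so that by [clin_ext] it is determined by its values on monomials. *)
Definition vanish n (d : 'I_n -> int) (N : nat) (f : series K d) :=
  forall m, (total_exp (val m) < N)%N -> f m = 0.

Definition clin n (d : 'I_n -> int) n' (d' : 'I_n' -> int)
    (T : series K d -> series K d') :=
  (forall c f g, T (c *: f + g) = c *: T f + T g) /\
  (forall N, exists M, forall f, vanish M f -> vanish N (T f)).

Section Clin.
Variables (n : nat) (d : 'I_n -> int) (n' : nat) (d' : 'I_n' -> int).
Implicit Types (T U : series K d -> series K d') (f g : series K d).

Lemma vanishW M N f : (M <= N)%N -> vanish N f -> vanish M f.
Proof. by move=> le h m hm; apply: h; apply: leq_trans le. Qed.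

Lemma clin0 T : clin T -> T 0 = 0.
Proof. by case=> h _; move: (h (-1) 0 0); rewrite !scaleN1r !addNr. Qed.

Lemma clinD T f g : clin T -> T (f + g) = T f + T g.
Proof. by case=> h _; move: (h 1 f g); rewrite !scale1r. Qed.

Lemma clinZ T c f : clin T -> T (c *: f) = c *: T f.
Proof. by move=> h; rewrite -[c *: f]addr0 h.1 clin0 // addr0. Qed.

Lemma clinB T f g : clin T -> T (f - g) = T f - T g.
Proof. by move=> h; rewrite -scaleN1r clinD // clinZ // scaleN1r. Qed.

Lemma clin_lsum T (I : Type) (s : seq I) (P : pred I) (F : I -> series K d) : clin T ->
  T (\sum_(x <- s | P x) F x) = \sum_(x <- s | P x) T (F x).
Proof.
by move=> h; apply: (big_morph T) => [x y|]; [rewrite clinD | rewrite clin0].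
Qed.

(** A single coefficient of [T f] and [U f] depends on finitely many orders of [f], and the
    truncation of [f] to a box of exponents is a finite combination of monomials. Testing only the
    monomials in the support of [f] lets them inherit the homogeneity of [f]. *)
Lemma clin_ext T U f : clin T -> clin U ->
  (forall m, f m != 0 -> T (mono K d (val m)) = U (mono K d (val m))) -> T f = U f.
Proof.
move=> cT cU H; apply: serE => m'.
have [M1 h1] := cT.2 (total_exp (val m')).+1; have [M2 h2] := cU.2 (total_exp (val m')).+1.
pose M := maxn M1 M2.
pose e (q : {ffun 'I_n -> 'I_M}) : {ffun 'I_n -> nat} := [ffun i => val (q i)].
pose g : series K d := \sum_q coef f (e q) *: mono K d (e q).
have van : vanish M (f - g).
  move=> m hm; rewrite addsE oppsE /g sumsE.
  have le i : (val m i < M)%N.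
    by apply: leq_ltn_trans hm; rewrite /total_exp (bigD1 i) //= leq_addr.
  pose q0 : {ffun 'I_n -> 'I_M} := [ffun i => Ordinal (le i)].
  have e0 : e q0 = val m by apply/ffunP => i; rewrite !ffunE.
  rewrite (bigD1 q0) //= big1 => [|q ne]; rewrite scalesE /mono.
    by rewrite e0 eqxx mulr1 addr0 coef_val subrr.
  case: eqP => [E|]; last by rewrite mulr0.
  case/eqP: ne; apply/ffunP => i; apply: val_inj; move/ffunP/(_ i): E.
  by rewrite -e0 !ffunE.
have eqg : T g = U g.
  rewrite /g !clin_lsum //; apply: eq_bigr => q _; rewrite !clinZ //.
  rewrite /coef; case: insubP => [m am hm|]; last by rewrite !scale0r.
  case: (eqVneq (f m) 0) => [->|nz]; first by rewrite !scale0r.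
  by rewrite -hm (H _ nz).
have -> : f = (f - g) + g by rewrite subrK.
rewrite (clinD _ _ cT) (clinD _ _ cU) eqg !addsE; congr (_ + _).
by rewrite (h1 _ (vanishW (leq_maxl _ _) van)) ?(h2 _ (vanishW (leq_maxr _ _) van)).
Qed.

Lemma clin_scale c T : clin T -> clin (fun f => c *: T f).
Proof.
case=> h1 h2; split=> [a f g|N].
  by rewrite h1 scalerDr !scalerA mulrC.
by have [M h] := h2 N; exists M => f /h v m /v; rewrite scalesE => ->; rewrite mulr0.
Qed.

Lemma clin_add T U : clin T -> clin U -> clin (fun f => T f + U f).
Proof.
case=> h1 h2 [k1 k2]; split=> [a f g|N].
  by rewrite h1 k1 scalerDr addrACA.
have [M h] := h2 N; have [L k] := k2 N; exists (maxn M L) => f v m hm.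
by rewrite addsE (h _ (vanishW (leq_maxl _ _) v)) ?(k _ (vanishW (leq_maxr _ _) v)) ?addr0.
Qed.

Lemma clin_zero : clin (fun f : series K d => 0 : series K d').
Proof. by split=> [a f g|N]; [rewrite scaler0 addr0 | exists 0%N]. Qed.

Lemma clin_sum (I : Type) (s : seq I) (P : pred I) (F : I -> series K d -> series K d') :
  (forall x, clin (F x)) -> clin (fun f => \sum_(x <- s | P x) F x f).
Proof.
move=> h; elim: s => [|x s ih].
  rewrite (_ : (fun f => _) = fun=> 0); last by apply/funext => f; rewrite big_nil.
  exact: clin_zero.
rewrite (_ : (fun f => _) =
  fun f => (if P x then F x f else 0) + \sum_(y <- s | P y) F y f); last first.
  by apply/funext => f; rewrite big_cons; case: (P x); rewrite ?add0r.
by apply: clin_add ih; case: (P x); [exact: h | exact: clin_zero].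
Qed.

End Clin.

Lemma clin_comp n (d : 'I_n -> int) n' (d' : 'I_n' -> int) n2 (d2 : 'I_n2 -> int)
    (T : series K d' -> series K d2) (U : series K d -> series K d') :
  clin T -> clin U -> clin (fun f => T (U f)).
Proof.
move=> [h1 h2] [k1 k2]; split=> [a f g|N]; first by rewrite k1 h1.
by have [M h] := h2 N; have [L k] := k2 M; exists L => f /k/h.
Qed.

Lemma clin_id n (d : 'I_n -> int) : clin (fun f : series K d => f).
Proof. by split=> // N; exists N. Qed.

Section Ops.
Variables (n : nat) (d : 'I_n -> int).
Implicit Types (f g h : series K d).

Lemma coef_vanish N f p : vanish N f -> (total_exp p < N)%N -> coef f p = 0.
Proof. by rewrite /coef; case: insubP => // m _ <- v /v. Qed.

Lemma clin_smull g : clin (fun f => smul f g).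
Proof.
split=> [c f f'|N]; first exact: smulPl.
exists N => f v m hm; rewrite /smul big1 // => s _.
rewrite (coef_vanish v) ?mul0r ?mulr0 //; apply: leq_ltn_trans hm.
by apply: leq_sum => i _; rewrite ffunE -ltnS.
Qed.

Lemma clin_smulr g : clin (fun f => smul g f).
Proof.
split=> [c f f'|N]; first exact: smulPr.
exists N => f v m hm; rewrite /smul big1 // => s _.
rewrite (coef_vanish v) ?mulr0 ?mulr0 //; apply: leq_ltn_trans hm.
by apply: leq_sum => i _; rewrite ffunE leq_subr.
Qed.

Lemma total_exp_incr p (i : 'I_n) : total_exp (incr_exp p i) = (total_exp p).+1.
Proof.
rewrite /total_exp /incr_exp (eq_bigr (fun j => p j + (j == i))%N); last by move=> j _; rewrite ffunE.
rewrite big_split /= [X in (_ + X)%N](bigD1 i) //= eqxx [X in (_ + (_ + X))%N]big1.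
  by rewrite addn0 addn1.
by move=> j /negbTE ->.
Qed.

Lemma clin_lder i : clin (fun f : series K d => lder i f).
Proof.
split=> [c f f'|N]; first exact: lderP.
by exists N.+1 => f v m hm; rewrite /lder (coef_vanish v) ?mulr0 ?total_exp_incr.
Qed.

Lemma clin_rder i : clin (fun f : series K d => rder i f).
Proof.
split=> [c f f'|N]; first exact: rderP.
by exists N.+1 => f v m hm; rewrite /rder (coef_vanish v) ?mulr0 ?total_exp_incr.
Qed.

End Ops.
End Continuity.

Ltac clin_step :=
  match goal with
  | |- forall _, _ => intro
  | |- clin (fun f => f) => exact: clin_id
  | |- clin (fun f => smul ?a f) => exact: (clin_smulr a)
  | |- clin (fun f => smul f ?a) => exact: (clin_smull a)
  | |- clin (fun f => lder ?a f) => exact: (clin_lder _ _ a)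
  | |- clin (fun f => rder ?a f) => exact: (clin_rder _ _ a)
  | |- clin (fun f => ?c *: @?T f) => apply: (@clin_scale _ _ _ _ _ c T)
  | |- clin (fun f => @?T f + @?U f) => apply: (@clin_add _ _ _ _ _ T U)
  | |- clin (fun f => \sum_(x <- ?s | @?P x) @?F x f) =>
      apply: (@clin_sum _ _ _ _ _ _ s P (fun x f => F x f))
  | |- clin (fun f => smul ?a (@?T f)) => apply: (clin_comp (clin_smulr a) (U := T))
  | |- clin (fun f => smul (@?T f) ?a) => apply: (clin_comp (clin_smull a) (U := T))
  | |- clin (fun f => lder ?a (@?T f)) => apply: (clin_comp (clin_lder _ _ a) (U := T))
  | |- clin (fun f => rder ?a (@?T f)) => apply: (clin_comp (clin_rder _ _ a) (U := T))
  | _ => by []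
  end.
Ltac clin_tac := cbv beta; repeat (clin_step; cbv beta).

(** * The graded commutative algebra of series and its derivations *)

Section Algebra.
Variables (K : fieldType) (n : nat) (d : 'I_n -> int).
Implicit Types (p q r : {ffun 'I_n -> nat}) (i j : 'I_n).
Implicit Types (f g h : series K d).
Notation mono := (mono K d).

Lemma smulA f g h : smul f (smul g h) = smul (smul f g) h.
Proof.
apply: (@clin_ext _ _ _ _ _ (fun f => smul f (smul g h)) (fun f => smul (smul f g) h));
  [clin_tac | clin_tac | move=> p _].
apply: (@clin_ext _ _ _ _ _ (fun g => smul _ (smul g h)) (fun g => smul (smul _ g) h));
  [clin_tac | clin_tac | move=> q _].
apply: (@clin_ext _ _ _ _ _ (fun h => smul _ (smul _ h)) (fun h => smul (smul _ _) h));
  [clin_tac | clin_tac | move=> r _].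
rewrite !smul_mono smulZl smulZr !smul_mono !scalerA maddA -!signr_addb.
rewrite merge_addl merge_addr !parE; congr (_ ^+ _ *: _).
by do 3!case: (par _).
Qed.

Lemma smulC a b f g : parhom a f -> parhom b g ->
  smul f g = ((-1) ^+ (a && b) : K) *: smul g f.
Proof.
move=> ha hb.
apply: (@clin_ext _ _ _ _ _ (fun f => smul f g) (fun f => _ *: smul g f));
  [clin_tac | clin_tac | move=> p /ha <-].
apply: (@clin_ext _ _ _ _ _ (fun g => smul _ g) (fun g => _ *: smul g _));
  [clin_tac | clin_tac | move=> q /hb <-].
rewrite !smul_mono scalerA maddC -signr_addb.
case apq: (admissible d (madd (val q) (val p))); last by rewrite mono0 ?apq // !scaler0.
(* The diagonal term of [merge_comm] is even: an odd variable cannot occur in both factors of an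
   admissible product. *)
have z : par (\sum_i ((val p i)%:Z * (val q i)%:Z) * (d i * d i)) = false.
  rewrite par_sum big1 // => i _; rewrite !parE andbb.
  move/forallP: apq => /(_ i); rewrite -/(par _) ffunE.
  case: (par (d i)); rewrite ?andbF //= => h.
  have [-> //|p0] := posnP (val p i).
  rewrite (_ : val q i = 0%N) ?andbF //; move: h p0 => /=; lia.
congr (_ ^+ _ *: _); move: (congr1 par (merge_comm d (val p) (val q))).
by rewrite !parE z addbF => <-; rewrite -addbA addbb addbF.
Qed.

Lemma sone_mono : sone K d = mono [ffun=> 0%N].
Proof. by []. Qed.

Lemma madd0 p : madd p [ffun=> 0%N] = p.
Proof. by apply/ffunP => i; rewrite !ffunE addn0. Qed.

Lemma below0 i : below d [ffun=> 0%N] i = 0.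
Proof. by rewrite /below big1 // => j _; rewrite ffunE mul0r. Qed.

Lemma merge0r p : merge_exponent d p [ffun=> 0%N] = 0.
Proof. by rewrite merge_below big1 // => i _; rewrite below0 mulr0. Qed.

Lemma smulf1 f : smul f (sone K d) = f.
Proof.
apply: (@clin_ext _ _ _ _ _ (fun f => smul f _) (fun f => f)); [clin_tac | clin_tac | move=> p _].
by rewrite sone_mono smul_mono merge0r madd0 scale1r.
Qed.

Lemma lderM i a f g : parhom a f ->
  lder i (smul f g) = smul (lder i f) g + ((-1) ^+ (par (d i) && a) : K) *: smul f (lder i g).
Proof.
move=> ha.
apply: (@clin_ext _ _ _ _ _ (fun f => lder i (smul f g))
  (fun f => smul (lder i f) g + _ *: smul f (lder i g)));
  [clin_tac | clin_tac | move=> p /ha <-].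
apply: (@clin_ext _ _ _ _ _ (fun g => lder i (smul _ g))
  (fun g => smul (lder i (mono (val p))) g + (_ : K) *: smul (mono (val p)) (lder i g)));
  [clin_tac | clin_tac | move=> q _].
exact: lder_smul_mono (valP p) (valP q).
Qed.

Let sg3 (a b c e f : bool) (x y : K) : a (+) b = c (+) e (+) f ->
  ((-1) ^+ a * x) * ((-1) ^+ b * y) = (-1) ^+ c * ((-1) ^+ e * y) * ((-1) ^+ f * x).
Proof.
move=> /(congr1 (fun u : bool => (-1 : K) ^+ u)); rewrite !signr_addb.
move: (_ ^+ a) (_ ^+ b) (_ ^+ c) (_ ^+ e) (_ ^+ f) => A B C E F h.
rewrite mulrACA h; ring.
Qed.

Lemma lder_lder i j f :
  lder i (lder j f) = ((-1) ^+ (par (d i) && par (d j)) : K) *: lder j (lder i f).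
Proof.
apply: (@clin_ext _ _ _ _ _ (fun f => lder i (lder j f)) (fun f => _ *: lder j (lder i f)));
  [clin_tac | clin_tac | move=> p _].
have ap := valP p; move: (val p) ap => {}p ap.
have aj := admissible_pred j ap; have ai := admissible_pred i ap.
rewrite !lder_mono // !lderZ !lder_mono // !scalerA.
(* For [i] equal to [j] the only sign to explain is that of an odd variable, whose exponent is at
   most 1, so that the second derivative is zero. *)
have [->|ne] := eqVneq i j.
  case E: (par (d j)); rewrite ?mul1r //=.
  move/forallP: ap => /(_ j); rewrite -/(par _) E /= ffunE eqxx => h.
  by rewrite (_ : p j - true = 0)%N ?mulr0 ?mul0r ?scale0r //; lia.
rewrite (_ : mpred (mpred p j) i = mpred (mpred p i) j); last first.
  by apply/ffunP => k; rewrite !ffunE -!subnDA addnC.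
have ne2 : (j == i) = false by rewrite eq_sym (negbTE ne).
rewrite !ffunE (negbTE ne) ne2 !subn0; congr (_ *: _).
have [->|pj] := posnP (p j); first by rewrite !(mulr0, mul0r).
have [->|pi] := posnP (p i); first by rewrite !(mulr0, mul0r).
rewrite [below d p i in RHS](_ : _ = below d (mpred p j) i + if (j < i)%N then d j else 0);
  last by rewrite [in LHS](mpredK pj) below_add below_unit.
rewrite [below d p j](_ : _ = below d (mpred p i) j + if (i < j)%N then d i else 0);
  last by rewrite [in LHS](mpredK pi) below_add below_unit.
apply: sg3; move: ne; rewrite -(inj_eq val_inj) neq_ltn.
case: (ltngtP i j) => //= _ _; rewrite !parE;
  by do 2!case: (par (below _ _ _)); do 2!case: (par (d _)).
Qed.

Lemma parhom_parity b f : parhom b (parity_part b f).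
Proof. by move=> m; rewrite /parity_part -/(par _); case: ifP => [/eqP -> // | _]; rewrite eqxx. Qed.

Lemma parity_part_hom b x f : parhom b f ->
  parity_part x f = if x == b then f else 0.
Proof.
move=> h; apply: serE => p; rewrite /parity_part -/(par _).
case: (eqVneq (f p) 0) => [e|/h ->]; first by rewrite e if_same; case: eqP.
by rewrite eq_sym; case: eqP.
Qed.

Lemma parity_sum f : f = parity_part false f + parity_part true f.
Proof.
by apply: serE => m; rewrite addsE /parity_part; case: odd; rewrite ?addr0 ?add0r.
Qed.

(** Reduces to arguments of definite parity, on which [rder] is [lder] up to a constant sign. *)
Lemma parity_ext n' (d' : 'I_n' -> int) (T U : series K d -> series K d') f :
  clin T -> clin U -> (forall b, parhom b (parity_part b f) ->
     T (parity_part b f) = U (parity_part b f)) -> T f = U f.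
Proof.
move=> cT cU H; rewrite (parity_sum f) !clinD // !H //; exact: parhom_parity.
Qed.

Lemma parhom0 b : parhom b (0 : series K d).
Proof. by move=> m; rewrite zerosE eqxx. Qed.

Lemma parhomZ b c f : parhom b f -> parhom b (c *: f).
Proof. by move=> h m; rewrite scalesE mulf_eq0 negb_or => /andP[_ /h]. Qed.

Lemma parhomD b f g : parhom b f -> parhom b g -> parhom b (f + g).
Proof.
move=> hf hg m; rewrite addsE; case: (eqVneq (f m) 0) => [->|/hf //].
by rewrite add0r => /hg.
Qed.

Lemma parhom_sum b (I : Type) (s : seq I) (P : pred I) (F : I -> series K d) :
  (forall x, P x -> parhom b (F x)) -> parhom b (\sum_(x <- s | P x) F x).
Proof.
by move=> h; apply: big_ind => //; [exact: parhom0 | move=> f g; exact: parhomD].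
Qed.

Lemma smul_support f g (m : monomial d) : smul f g m != 0 ->
  exists p q : monomial d, [/\ f p != 0, g q != 0 & val m = madd (val p) (val q)].
Proof.
move=> nz; apply: contrapT => H; case/eqP: nz; rewrite /smul big1 // => s _.
set p := [ffun i => _]; set q := [ffun i => _].
rewrite /coef; case: insubP => [mp _ ep|_]; last by rewrite mul0r mulr0.
case: insubP => [mq _ eq|_]; last by rewrite mulr0 mulr0.
case: (eqVneq (f mp) 0) => [->|fa]; first by rewrite mul0r mulr0.
case: (eqVneq (g mq) 0) => [->|gb]; first by rewrite !mulr0.
case: H; exists mp, mq; split=> //; rewrite ep eq.
by apply/ffunP => i; rewrite !ffunE subnKC // -ltnS.
Qed.

Lemma coef_support f p : coef f p != 0 -> exists2 m : monomial d, f m != 0 & val m = p.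
Proof. by rewrite /coef; case: insubP => [m _ <- ?|_]; [exists m | rewrite eqxx]. Qed.

Lemma incr_exp_madd p i : incr_exp p i = madd p (munit i).
Proof. by apply/ffunP => j; rewrite !ffunE. Qed.

Lemma lder_support i f (m : monomial d) : lder i f m != 0 ->
  exists2 m' : monomial d, f m' != 0 & val m' = madd (val m) (munit i).
Proof.
rewrite -incr_exp_madd => nz; apply: coef_support.
by apply: contraNneq nz; rewrite /lder => ->; rewrite mulr0.
Qed.

Lemma rder_support i f (m : monomial d) : rder i f m != 0 ->
  exists2 m' : monomial d, f m' != 0 & val m' = madd (val m) (munit i).
Proof.
rewrite -incr_exp_madd => nz; apply: coef_support.
by apply: contraNneq nz; rewrite /rder => ->; rewrite mulr0.
Qed.

Lemma parhom_smul a b f g : parhom a f -> parhom b g -> parhom (a (+) b) (smul f g).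
Proof.
move=> ha hb m /smul_support[p [q [/ha <- /hb <- ->]]].
by rewrite expdegD parD.
Qed.

Lemma homogeneous_smul x y f g :
  homogeneous x f -> homogeneous y g -> homogeneous (x + y) (smul f g).
Proof.
by move=> ha hb m /smul_support[p [q [/ha <- /hb <- ->]]]; rewrite expdegD.
Qed.

Lemma homogeneous_lder i x f : homogeneous x f -> homogeneous (x - d i) (lder i f).
Proof.
by move=> h m /lder_support[m' /h <- ->]; rewrite expdegD expdeg_unit addrK.
Qed.

Lemma homogeneous_rder i x f : homogeneous x f -> homogeneous (x - d i) (rder i f).
Proof.
by move=> h m /rder_support[m' /h <- ->]; rewrite expdegD expdeg_unit addrK.
Qed.

Lemma homogeneous0 x : homogeneous x (0 : series K d).
Proof. by move=> m; rewrite zerosE eqxx. Qed.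

Lemma homogeneousZ x c f : homogeneous x f -> homogeneous x (c *: f).
Proof. by move=> h m; rewrite scalesE mulf_eq0 negb_or => /andP[_ /h]. Qed.

Lemma homogeneousD x f g : homogeneous x f -> homogeneous x g -> homogeneous x (f + g).
Proof.
move=> hf hg m; rewrite addsE; case: (eqVneq (f m) 0) => [->|/hf //].
by rewrite add0r => /hg.
Qed.

Lemma homogeneous_sum x (I : Type) (s : seq I) (P : pred I) (F : I -> series K d) :
  (forall y, P y -> homogeneous x (F y)) -> homogeneous x (\sum_(y <- s | P y) F y).
Proof.
by move=> h; apply: big_ind => //; [exact: homogeneous0 | move=> f g; exact: homogeneousD].
Qed.

Lemma homogeneous_parhom x f : homogeneous x f -> parhom (par x) f.
Proof. by move=> h m /h <-. Qed.

Lemma parhom_lder i b f : parhom b f -> parhom (b (+) par (d i)) (lder i f).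
Proof.
move=> h m /lder_support[m' /h <- ->].
by rewrite expdegD expdeg_unit !parE -addbA addbb addbF.
Qed.

Lemma parhom_rder i b f : parhom b f -> parhom (b (+) par (d i)) (rder i f).
Proof. by move=> h; rewrite (rder_lder i h); apply: parhomZ; apply: parhom_lder. Qed.

(** On each parity a right derivative is a signed left derivative, so this rule and the two
    commutation rules below are inherited from [lderM] and [lder_lder]. *)
Lemma rderM i b f g : parhom b g ->
  rder i (smul f g) = smul f (rder i g) + ((-1) ^+ (par (d i) && b) : K) *: smul (rder i f) g.
Proof.
move=> hb.
apply: (@parity_ext _ _ (fun f => rder i (smul f g))
  (fun f => smul f (rder i g) + _ *: smul (rder i f) g)); [clin_tac | clin_tac |].
move=> a; move: (parity_part a f) => {}f ha.
rewrite (rder_lder i (parhom_smul ha hb)) (rder_lder i ha) (rder_lder i hb).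
rewrite (lderM _ _ ha) smulZl smulZr !scalerA scalerDr scalerA addrC -!signr_addb.
by congr (_ ^+ _ *: _ + _ ^+ _ *: _); move: ha hb => _ _; case: a; case: b; case: (par (d i)).
Qed.

Lemma rder_rder i j f :
  rder i (rder j f) = ((-1) ^+ (par (d i) && par (d j)) : K) *: rder j (rder i f).
Proof.
apply: (@parity_ext _ _ (fun f => rder i (rder j f)) (fun f => _ *: rder j (rder i f)));
  [clin_tac | clin_tac |].
move=> a; move: (parity_part a f) => {}f ha.
rewrite (rder_lder i (parhom_rder (i := j) ha)) (rder_lder j (parhom_rder (i := i) ha)).
rewrite (rder_lder i ha) (rder_lder j ha) !lderZ !scalerA lder_lder scalerA -!signr_addb.
by congr (_ ^+ _ *: _); case: a {ha}; case: (par (d i)); case: (par (d j)).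
Qed.

Lemma rder_lder_comm i j f : rder i (lder j f) = lder j (rder i f).
Proof.
apply: (@parity_ext _ _ (fun f => rder i (lder j f)) (fun f => lder j (rder i f)));
  [clin_tac | clin_tac |].
move=> a; move: (parity_part a f) => {}f ha.
rewrite (rder_lder i (parhom_lder (i := j) ha)) (rder_lder i ha) lderZ lder_lder scalerA.
by rewrite -!signr_addb; congr (_ ^+ _ *: _); case: a {ha}; case: (par (d i)); case: (par (d j)).
Qed.

Lemma rder_mono p i : admissible d p ->
  rder i (mono p) = ((-1) ^+ par (d i * above d p i) * (p i)%:R : K) *: mono (mpred p i).
Proof.
move=> ap.
have h : parhom (par (expdeg d p)) (mono p).
  by move=> m; rewrite /mono; case: (val m =P p) => [-> //|_]; rewrite eqxx.
rewrite (rder_lder i h) lder_mono // scalerA mulrA -signr_addb.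
have [->|p0] := posnP (p i); first by rewrite !mulr0 !scale0r.
congr (_ ^+ _ * _ *: _); rewrite (expdeg_split d p i) !parE.
case E: (par (d i)) => //=.
move/forallP: ap => /(_ i); rewrite -/(par _) E /= => h1.
have -> : p i = 1%N by lia.
by do 2!case: (par _).
Qed.

End Algebra.

(** * Polyvector fields *)

Section Polyvec.
Variables (K : fieldType) (m : nat) (edeg : 'I_m -> int).
Notation td := (tdeg edeg).
Notation tp := (tpsideg edeg).
Notation O := (functionsV K edeg).
Notation T := (polyvec K edeg).
Implicit Types (p q : {ffun 'I_m -> nat}) (P Q : {ffun 'I_(m + m) -> nat}).
Implicit Types (f g h : O) (A B : T) (a b c : 'I_m).

(* [ext] and [tpart] translate between t-exponents and (t, psi)-exponents,
   [proj] is the restriction to psi = 0. *)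
Definition ext p : {ffun 'I_(m + m) -> nat} :=
  [ffun i => match fintype.split i with inl a => p a | inr _ => 0%N end].
Definition tpart P : {ffun 'I_m -> nat} := [ffun a => P (lshift m a)].

Definition proj A : O := fun p : monomial td => coef A (ext (val p)).

Lemma split_l a : fintype.split (lshift m a : 'I_(m + m)) = inl a.
Proof. by rewrite -(unsplitK (inl a : 'I_m + 'I_m)). Qed.
Lemma split_r a : fintype.split (rshift m a : 'I_(m + m)) = inr a.
Proof. by rewrite -(unsplitK (inr a : 'I_m + 'I_m)). Qed.

Lemma tp_l a : tp (lshift m a) = td a. Proof. by rewrite /tpsideg split_l. Qed.
Lemma tp_r a : tp (rshift m a) = psideg edeg a. Proof. by rewrite /tpsideg split_r. Qed.
Lemma ext_l p a : ext p (lshift m a) = p a. Proof. by rewrite ffunE split_l. Qed.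
Lemma ext_r p a : ext p (rshift m a) = 0%N. Proof. by rewrite ffunE split_r. Qed.

Lemma tp_ffunP P Q : (forall a, P (lshift m a) = Q (lshift m a)) ->
  (forall a, P (rshift m a) = Q (rshift m a)) -> P = Q.
Proof.
move=> h1 h2; apply/ffunP => i; rewrite -(splitK i).
by case: (fintype.split i) => a /=; [exact: h1 | exact: h2].
Qed.

Lemma extK : cancel ext tpart.
Proof. by move=> p; apply/ffunP => a; rewrite ffunE ext_l. Qed.

Lemma psi_weight_ext p : psi_weight (ext p) = 0%N.
Proof. by rewrite /psi_weight big1 // => a _; rewrite ext_r. Qed.

Lemma psi_weight0 P : psi_weight P = 0%N -> P = ext (tpart P).
Proof.
move=> /eqP; rewrite sum_nat_eq0 => /forallP h.
apply: tp_ffunP => a; rewrite ?ext_l ?ext_r ?ffunE //.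
by apply/eqP; exact: (h a).
Qed.

Lemma psi_weightD P Q : psi_weight (madd P Q) = (psi_weight P + psi_weight Q)%N.
Proof. by rewrite /psi_weight -big_split; apply: eq_bigr => a _; rewrite ffunE. Qed.

Lemma psi_weight_unit_l a : psi_weight (munit (lshift m a)) = 0%N.
Proof. by rewrite /psi_weight big1 // => b _; rewrite ffunE eq_rlshift. Qed.

Lemma psi_weight_unit_r a : psi_weight (munit (rshift m a)) = 1%N.
Proof.
rewrite /psi_weight (bigD1 a) //= ffunE eqxx big1 // => b ba.
by rewrite ffunE eq_rshift (negbTE ba).
Qed.

Lemma admissible_ext p : admissible tp (ext p) = admissible td p.
Proof.
apply/forallP/forallP => h.
  by move=> a; move: (h (lshift m a)); rewrite tp_l ext_l.
by move=> i; rewrite /tpsideg ffunE; case: (fintype.split i) => a; rewrite ?implybT.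
Qed.

Lemma expdeg_tp P :
  expdeg tp P = expdeg td (tpart P) + \sum_a (P (rshift m a))%:Z * psideg edeg a.
Proof.
rewrite /expdeg big_split_ord /=; congr (_ + _); apply: eq_bigr => a _.
  by rewrite ffunE tp_l.
by rewrite tp_r.
Qed.

Lemma expdeg_ext p : expdeg tp (ext p) = expdeg td p.
Proof.
rewrite expdeg_tp extK big1 ?addr0 // => a _; by rewrite ext_r mul0r.
Qed.

Lemma ext_madd p q : ext (madd p q) = madd (ext p) (ext q).
Proof. by apply: tp_ffunP => a; rewrite ?ext_l ?ext_r ![madd _ _ _]ffunE ?ext_l ?ext_r. Qed.

Lemma ext_mpred p a : ext (mpred p a) = mpred (ext p) (lshift m a).
Proof.
apply: tp_ffunP => b; rewrite ?ext_l ?ext_r ![mpred _ _ _]ffunE ?ext_l ?ext_r //.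
Qed.

Lemma ext_incr p a : ext (incr_exp p a) = incr_exp (ext p) (lshift m a).
Proof.
apply: tp_ffunP => b; rewrite ?ext_l ?ext_r ![incr_exp _ _ _]ffunE ?ext_l ?ext_r.
  by rewrite (inj_eq (@lshift_inj _ _)).
by rewrite eq_rlshift.
Qed.

Lemma below_ext p a : below tp (ext p) (lshift m a) = below td p a.
Proof.
rewrite /below big_split_ord /= [X in _ + X]big1 ?addr0 => [|b _].
  by apply: eq_bigr => b _; rewrite tp_l ext_l.
by rewrite ext_r mul0r.
Qed.

Lemma merge_ext p q : merge_exponent tp (ext p) (ext q) = merge_exponent td p q.
Proof.
rewrite !merge_below big_split_ord /= [X in _ + X]big1 ?addr0 => [|b _].
  by apply: eq_bigr => b _; rewrite tp_l ext_l below_ext.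
by rewrite ext_r !mul0r.
Qed.

Lemma total_exp_ext p : total_exp (ext p) = total_exp p.
Proof.
rewrite /total_exp big_split_ord /= [X in (_ + X)%N]big1 ?addn0 => [|b _].
  by apply: eq_bigr => b _; rewrite ext_l.
by rewrite ext_r.
Qed.

Lemma embedE f (P : monomial tp) : embed f P =
  if psi_weight (val P) == 0%N then coef f (tpart (val P)) else 0.
Proof. by []. Qed.

Lemma clin_embed : clin (fun f : O => embed f).
Proof.
split=> [c f g|N].
  apply: serE => P; rewrite addsE scalesE !embedE coef_linear.
  by case: ifP => // _; rewrite mulr0 addr0.
exists N => f v P hP; rewrite embedE; case: eqP => // w0; apply: (coef_vanish v).
by rewrite -total_exp_ext -psi_weight0.
Qed.

Lemma clin_proj : clin proj.
Proof.
split=> [c f g|N]; first by apply: serE => p; rewrite addsE scalesE /proj coef_linear.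
by exists N => f v p hp; rewrite /proj (coef_vanish v) // total_exp_ext.
Qed.

Lemma embed_mono p : embed (mono K td p : O) = mono K tp (ext p).
Proof.
apply: serE => P; rewrite embedE coef_mono /mono.
case: eqP => [w0|w]; last first.
  by case: eqP w => // ->; rewrite psi_weight_ext.
rewrite [in RHS](psi_weight0 w0) (inj_eq (can_inj extK)).
case: eqP => //= e; have := valP P; rewrite /= (psi_weight0 w0) admissible_ext e.
by move=> ->.
Qed.

Lemma proj_embed f : proj (embed f) = f.
Proof.
apply: serE => p; rewrite /proj /coef; case: insubP => [P _ e|].
  by rewrite embedE e psi_weight_ext eqxx extK coef_val.
by rewrite admissible_ext (valP p).
Qed.

Lemma proj_mono P : proj (mono K tp P) =
  if psi_weight P == 0%N then mono K td (tpart P) else 0.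
Proof.
case: eqP => [w0|w].
  by rewrite -[in RHS](proj_embed (mono K td _)) embed_mono -psi_weight0.
apply: serE => p; rewrite /proj coef_mono; case: eqP => //= e.
by case: w; rewrite -e psi_weight_ext.
Qed.

Lemma embedM f g : embed (smul f g) = smul (embed f) (embed g).
Proof.
apply: (@clin_ext _ _ _ _ _ (fun f => embed (smul f g)) (fun f => smul (embed f) (embed g))).
- exact: (clin_comp clin_embed (clin_smull g)).
- exact: (clin_comp (clin_smull (embed g)) clin_embed).
move=> p _.
apply: (@clin_ext _ _ _ _ _ (fun g => embed (smul _ g)) (fun g => smul (embed _) (embed g))).
- exact: (clin_comp clin_embed (clin_smulr _)).
- exact: (clin_comp (clin_smulr _) clin_embed).
move=> q _; rewrite smul_mono (clinZ _ _ clin_embed) !embed_mono smul_mono.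
by rewrite merge_ext ext_madd.
Qed.

(** The psi-weight is additive, so a product of monomials survives only if both are free of psi; on
    these [proj] inverts the multiplicative [embed]. *)
Lemma projM A B : proj (smul A B) = smul (proj A) (proj B).
Proof.
apply: (@clin_ext _ _ _ _ _ (fun A => proj (smul A B)) (fun A => smul (proj A) (proj B))).
- exact: (clin_comp clin_proj (clin_smull _)).
- exact: (clin_comp (clin_smull _) clin_proj).
move=> P _.
apply: (@clin_ext _ _ _ _ _ (fun B => proj (smul _ B)) (fun B => smul (proj _) (proj B))).
- exact: (clin_comp clin_proj (clin_smulr _)).
- exact: (clin_comp (clin_smulr _) clin_proj).
move=> Q _.
have [wP|wP] := eqVneq (psi_weight (val P)) 0%N; last first.
  rewrite smul_mono (clinZ _ _ clin_proj) !proj_mono psi_weightD addn_eq0.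
  by rewrite (negbTE wP) scaler0 smul0l.
have [wQ|wQ] := eqVneq (psi_weight (val Q)) 0%N; last first.
  rewrite smul_mono (clinZ _ _ clin_proj) !proj_mono psi_weightD addn_eq0.
  by rewrite (negbTE wQ) andbF scaler0 smul0r.
by rewrite (psi_weight0 wP) (psi_weight0 wQ) -!embed_mono -embedM !proj_embed.
Qed.

Lemma lder_embed a f : lder (lshift m a) (embed f) = embed (lder a f).
Proof.
apply: (@clin_ext _ _ _ _ _ (fun f => lder (lshift m a) (embed f)) (fun f => embed (lder a f))).
- exact: (clin_comp (clin_lder _ _ _) clin_embed).
- exact: (clin_comp clin_embed (clin_lder _ _ _)).
move=> p _; have ap := valP p; rewrite embed_mono !lder_mono ?admissible_ext //.
by rewrite (clinZ _ _ clin_embed) embed_mono below_ext ext_mpred ext_l tp_l.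
Qed.

Lemma rder_embed a f : rder (rshift m a) (embed f) = 0.
Proof.
apply: (@clin_ext _ _ _ _ _ (fun f => rder (rshift m a) (embed f)) (fun f => 0)).
- exact: (clin_comp (clin_rder _ _ _) clin_embed).
- exact: clin_zero.
move=> p _; have ap := valP p; rewrite embed_mono !rder_mono ?admissible_ext //.
by rewrite ext_r mulr0 scale0r.
Qed.

Lemma proj_lder a A : proj (lder (lshift m a) A) = lder a (proj A).
Proof.
apply: serE => p; rewrite /proj {1}/coef; case: insubP => [P _ e|]; last first.
  by rewrite admissible_ext (valP p).
rewrite /lder -/(below tp _ _) -/(below td _ _) e below_ext ext_l tp_l.
congr (_ * _); rewrite -ext_incr [in RHS]/coef; case: insubP => [q _ -> //|na].
by rewrite coef_inadm // admissible_ext.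
Qed.

Lemma embed_support f (P : monomial tp) : embed f P != 0 ->
  exists2 p : monomial td, f p != 0 & val P = ext (val p).
Proof.
rewrite embedE; case: ifP => [/eqP w|_]; last by rewrite eqxx.
by move/coef_support => [p fp e]; exists p => //; rewrite e -psi_weight0.
Qed.

Lemma parhom_embed x f : parhom x f -> parhom x (embed f).
Proof. by move=> h P /embed_support[p /h <- ->]; rewrite expdeg_ext. Qed.

Lemma homogeneous_embed x f : homogeneous x f -> homogeneous x (embed f).
Proof. by move=> h P /embed_support[p /h <- ->]; rewrite expdeg_ext. Qed.

Lemma parhom_proj x A : parhom x A -> parhom x (proj A).
Proof.
by move=> h p /coef_support[P /h <- e]; rewrite -expdeg_ext -e.
Qed.

Lemma homogeneous_proj x A : homogeneous x A -> homogeneous x (proj A).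
Proof.
by move=> h p /coef_support[P /h <- e]; rewrite -expdeg_ext -e.
Qed.

End Polyvec.

(** * Brackets as iterated actions *)

Section WordSum.
Variables (R : nmodType) (I : finType).

(** A sum over tuples in a form that allows induction on the length, from the front by definition
    and from the back by [word_sum_rcons], with summands defined on plain sequences. *)
Fixpoint word_sum (n : nat) (F : seq I -> R) : R :=
  if n is n'.+1 then \sum_c word_sum n' (fun s => F (c :: s)) else F [::].

Lemma word_sumE n (F : seq I -> R) : \sum_(a : n.-tuple I) F a = word_sum n F.
Proof.
elim: n F => [|n ih] F /=.
  by rewrite (big_pred1 [tuple]) // => a; apply/esym/eqP; exact: tuple0.
transitivity (\sum_c \sum_(t : n.-tuple I) F (c :: t)); last first.
  by apply: eq_bigr => c _; rewrite (ih (fun s => F (c :: s))).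
rewrite pair_big /=.
pose h (x : I * n.-tuple I) : n.+1.-tuple I := [tuple of x.1 :: x.2].
pose h' (t : n.+1.-tuple I) : I * n.-tuple I := (thead t, [tuple of behead t]).
rewrite (reindex_onto h h') /=; last by move=> t _; rewrite [RHS]tuple_eta.
apply: eq_big => [[c t]|[c t] _] //=.
by apply/eqP; rewrite /h' /h /=; congr pair; apply: val_inj.
Qed.

Lemma eq_word_sum n (F F' : seq I -> R) :
  (forall s, size s = n -> F s = F' s) -> word_sum n F = word_sum n F'.
Proof.
elim: n F F' => [|n ih] F F' h /=; first exact: h.
by apply: eq_bigr => c _; apply: ih => s hs; apply: h; rewrite /= hs.
Qed.

Lemma word_sum_sum n (J : Type) (r : seq J) (P : pred J) (F : J -> seq I -> R) :
  word_sum n (fun s => \sum_(j <- r | P j) F j s) = \sum_(j <- r | P j) word_sum n (F j).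
Proof.
elim: n F => [|n ih] F //=.
by rewrite exchange_big; apply: eq_bigr => c _; apply: ih.
Qed.

Lemma word_sum_rcons n (F : seq I -> R) :
  word_sum n.+1 F = \sum_c word_sum n (fun s => F (rcons s c)).
Proof.
elim: n F => [|n ih] F //.
transitivity (\sum_c \sum_c' word_sum n (fun s => F (c :: rcons s c'))).
  by apply: eq_bigr => c _; exact: (ih (fun s => F (c :: s))).
by rewrite exchange_big.
Qed.

Lemma word_sum1 n (F : seq I -> R) s0 : size s0 = n ->
  (forall s, size s = n -> s != s0 -> F s = 0) -> word_sum n F = F s0.
Proof.
move=> sz h; rewrite -word_sumE (bigD1 (Tuple (introT eqP sz))) //= big1 ?addr0 // => t.
by move=> ne; apply: h; [exact: size_tuple | exact: ne].
Qed.

Lemma word_sumD n (F F' : seq I -> R) : word_sum n (fun s => F s + F' s) = word_sum n F + word_sum n F'.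
Proof.
elim: n F F' => [|n ih] F F' //=.
by rewrite -big_split; apply: eq_bigr => c _; apply: ih.
Qed.

End WordSum.

Lemma word_sum_morph (R R' : nmodType) (I : finType) (T : R -> R') n (F : seq I -> R) :
  T 0 = 0 -> (forall x y, T (x + y) = T x + T y) -> T (word_sum n F) = word_sum n (fun s => T (F s)).
Proof.
move=> h0 hD; elim: n F => [|n ih] F //=.
by rewrite (big_morph T hD h0); apply: eq_bigr => c _; apply: ih.
Qed.

Lemma clin_word_sum (K : fieldType) n (d : 'I_n -> int) n' (d' : 'I_n' -> int)
    (T : series K d -> series K d') (I : finType) k (F : seq I -> series K d) :
  clin T -> T (word_sum k F) = word_sum k (fun s => T (F s)).
Proof.
by move=> cT; apply: word_sum_morph => [|x y]; [apply: clin0 | apply: clinD].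
Qed.

(** * The operators X_f and the recovery of coefficients *)

Section Action.
Variables (K : fieldType) (m : nat) (edeg : 'I_m -> int).
Notation td := (tdeg edeg).
Notation tp := (tpsideg edeg).
Notation O := (functionsV K edeg).
Notation T := (polyvec K edeg).
Implicit Types (f g h : O) (A B : T) (c : 'I_m).
Notation dpsi c := (rder (rshift m c)).
Notation psiv := (@psi K m edeg).

Definition tpar c := par (td c).

Lemma par_tp_r c : par (tp (rshift m c)) = ~~ tpar c.
Proof. by rewrite tp_r /psideg /tpar /tdeg !parE. Qed.

(* A . f *)
Definition act f A : T := \sum_c smul (dpsi c A) (embed (lder c f)).

Lemma clin_actr f : clin (act f).
Proof.
apply: (@clin_sum _ _ _ _ _ _ (index_enum _) predT (fun c A => smul (dpsi c A) (embed (lder c f)))).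
by move=> c; exact: (clin_comp (clin_smull _) (clin_rder _ _ _)).
Qed.

Lemma clin_actl A : clin (act^~ A).
Proof.
apply: (@clin_sum _ _ _ _ _ _ (index_enum _) predT (fun c f => smul (dpsi c A) (embed (lder c f)))).
move=> c; apply: (clin_comp (clin_smulr _)).
exact: (clin_comp (@clin_embed _ _ _) (clin_lder _ _ _)).
Qed.

(** The psi-derivatives kill functions, so X_f is linear over functions multiplied from the right,
    up to the sign of moving [h] past X_f, which has parity |f| + 1. *)
Lemma act_smul_embed x y f h B : parhom x f -> parhom y h ->
  act f (smul B (embed h)) = ((-1) ^+ (~~ x && y) : K) *: smul (act f B) (embed h).
Proof.
move=> hf hh; rewrite /act (clin_lsum _ _ _ (clin_smull (embed h))) scaler_sumr.
apply: eq_bigr => c _.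
rewrite (rderM _ _ (parhom_embed hh)) rder_embed smul0r add0r smulZl par_tp_r.
rewrite -!smulA (smulC (parhom_embed hh) (parhom_embed (parhom_lder (i := c) hf))).
rewrite smulZr scalerA -signr_addb; congr (_ ^+ _ *: _); rewrite -/(tpar c).
by move: (tpar c) x y {hf hh}; do 3!case.
Qed.

Lemma act_smul x y f g A : parhom x f -> parhom y g ->
  act (smul f g) A = smul (act f A) (embed g) +
    ((-1) ^+ (x && y) : K) *: smul (act g A) (embed f).
Proof.
move=> hf hg; rewrite /act !(clin_lsum _ _ _ (clin_smull _)) scaler_sumr -big_split.
apply: eq_bigr => c _ /=.
rewrite (lderM _ _ hf) (clinD _ _ (@clin_embed _ _ _)) (clinZ _ _ (@clin_embed _ _ _)).
rewrite !embedM (clinD _ _ (clin_smulr _)) smulZr !smulA -!smulA; congr (_ + _).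
rewrite (smulC (parhom_embed hf) (parhom_embed (parhom_lder (i := c) hg))).
rewrite smulZr scalerA -signr_addb; congr (_ ^+ _ *: _); rewrite -/(tpar c).
by move: (tpar c) x y {hf hg}; do 3!case.
Qed.

(** The outer psi-derivative does not see the factor [embed (lder c' g)]; what remains is a double
    psi-derivative, which is graded commutative. The sign is that of two operators of parities |f| +
    1 and |g| + 1. *)
Lemma act_act x y f g A : parhom x f -> parhom y g ->
  act f (act g A) = ((-1) ^+ (~~ x && ~~ y) : K) *: act g (act f A).
Proof.
move=> hf hg.
have E (u v : bool) (p q : O) (hp : parhom u p) (hq : parhom v q) : act p (act q A) =
    \sum_c \sum_c' ((-1) ^+ (~~ tpar c && (v (+) tpar c')) : K) *:
     smul (dpsi c (dpsi c' A)) (smul (embed (lder c' q)) (embed (lder c p))).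
  apply: eq_bigr => c _; rewrite /act (clin_lsum _ _ _ (clin_rder _ _ _)).
  rewrite (clin_lsum _ _ _ (clin_smull _)); apply: eq_bigr => c' _.
  rewrite (rderM _ _ (parhom_embed (parhom_lder (i := c') hq))) rder_embed smul0r add0r.
  by rewrite smulZl par_tp_r -/(tpar c') smulA.
rewrite (E _ _ _ _ hf hg) (E _ _ _ _ hg hf) exchange_big scaler_sumr.
apply: eq_bigr => c _; rewrite scaler_sumr; apply: eq_bigr => c' _.
rewrite rder_rder !par_tp_r smulZl.
rewrite (smulC (parhom_embed (parhom_lder (i := c) hg)) (parhom_embed (parhom_lder (i := c') hf))).
rewrite smulZr !scalerA -!signr_addb; congr (_ ^+ _ *: _); rewrite -!/(tpar _).
by move: (tpar c) (tpar c') x y {E hf hg}; do 4!case.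
Qed.

Lemma parhom_act x y f A : parhom x f -> parhom y A -> parhom (~~ (x (+) y)) (act f A).
Proof.
move=> hf hA; apply: parhom_sum => c _.
have -> : ~~ (x (+) y) = (y (+) par (tp (rshift m c))) (+) (x (+) tpar c).
  by rewrite par_tp_r; move: (tpar c) x y {hf hA}; do 3!case.
by apply: parhom_smul; [apply: parhom_rder | apply: parhom_embed; apply: parhom_lder].
Qed.

Lemma homogeneous_act x y f A : homogeneous x f -> homogeneous y A ->
  homogeneous (x + y - 1) (act f A).
Proof.
move=> hf hA; apply: homogeneous_sum => c _.
have -> : x + y - 1 = (y - tp (rshift m c)) + (x - td c).
  rewrite tp_r /psideg; ring.
by apply: homogeneous_smul; [apply: homogeneous_rder | apply: homogeneous_embed; apply: homogeneous_lder].
Qed.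

Definition chain (a : seq 'I_m) A : T := foldr (fun c B => dpsi c B) A a.
Definition acts (fs : seq O) A : T := foldr act A fs.
Definition deriv_prod (a : seq 'I_m) (fs : seq O) : O :=
  foldr (fun af x => smul (lder af.1 af.2) x) (sone K td) (zip a fs).

Fixpoint parhoms (bs : seq bool) (fs : seq O) : Prop :=
  match bs, fs with
  | b :: bs', f :: fs' => parhom b f /\ parhoms bs' fs'
  | [::], [::] => True
  | _, _ => False
  end.

Definition xor (bs : seq bool) := foldr addb false bs.

(* [word_sign a bs] is the parity of [bracket_exponent]; [arg_sign bs] is that of
   \sum_(i < j) |f_j| (|f_i| + 1), the rest of the sign produced by moving the
   psi-derivatives in X_(f_1) ... X_(f_n) A past the factors already there. *)
Fixpoint word_sign (a : seq 'I_m) (bs : seq bool) : bool :=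
  match a, bs with
  | c :: a', b :: bs' => word_sign a' bs' (+) (~~ b && xor (map tpar a'))
  | _, _ => false
  end.

Fixpoint arg_sign (bs : seq bool) : bool :=
  if bs is b :: bs' then arg_sign bs' (+) (~~ b && xor bs') else false.

Lemma clin_acts fs : clin (acts fs).
Proof.
elim: fs => [|f fs ih] /=; first exact: clin_id.
exact: (clin_comp (clin_actr f) ih).
Qed.

Lemma parhom_sone : parhom false (sone K td).
Proof.
move=> p; rewrite /sone; case: (val p =P _) => [-> _|_]; last by rewrite eqxx.
by rewrite /expdeg big1 // => i _; rewrite ffunE mul0r.
Qed.

Lemma parhom_deriv_prod a fs bs : parhoms bs fs -> size a = size fs ->
  parhom (xor bs (+) xor (map tpar a)) (deriv_prod a fs).
Proof.
elim: fs a bs => [|f fs ih] [|c a] [|b bs] //=; first by move=> _ _; exact: parhom_sone.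
move=> [hf hfs] [sz]; rewrite -addbA (addbCA (xor bs)) addbA.
by apply: parhom_smul; [apply: parhom_lder | apply: ih].
Qed.

Lemma acts_word_sum fs bs A : parhoms bs fs ->
  acts fs A = word_sum (size fs) (fun a => ((-1) ^+ (word_sign a bs (+) arg_sign bs) : K) *:
     smul (chain a A) (embed (deriv_prod a fs))).
Proof.
elim: fs bs => [|f fs ih] [|b bs] //=.
  move=> _; rewrite /deriv_prod /= scale1r.
  have -> : embed (sone K td) = sone K tp.
    rewrite !sone_mono embed_mono; congr (mono _ _ _); apply: tp_ffunP => a;
    by rewrite ?ext_l ?ext_r !ffunE.
  by rewrite smulf1.
move=> [hf hfs]; rewrite (ih _ hfs) (clin_word_sum _ _ (clin_actr f)) -word_sum_sum.
apply: eq_word_sum => a sz; rewrite (clinZ _ _ (clin_actr f)).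
rewrite (act_smul_embed _ hf (parhom_deriv_prod hfs sz)) scalerA -signr_addb.
rewrite (clin_lsum _ _ _ (clin_smull _)) scaler_sumr; apply: eq_bigr => c _.
rewrite -smulA -embedM; congr (_ ^+ _ *: _).
move: (xor [seq _ | _ <- _]) => u {hf}.
by case: b; case: u; case: (word_sign _ _); case: (arg_sign _); case: (xor _).
Qed.

Lemma rder_weight_part w c A :
  dpsi c (weight_part w.+1 A) = weight_part w (dpsi c A).
Proof.
apply: serE => P; rewrite /weight_part /rder -/(weight_part w.+1 A).
have -> : (psi_weight (val P) == w) = (psi_weight (incr_exp (val P) (rshift m c)) == w.+1).
  by rewrite incr_exp_madd psi_weightD psi_weight_unit_r addn1.
rewrite /coef; case: insubP => [Q _ <-|_]; last by rewrite !mulr0 if_same.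
by rewrite /weight_part; case: ifP; rewrite ?mulr0.
Qed.

Lemma proj_weight_part A : proj (weight_part 0 A) = proj A.
Proof.
apply: serE => p; rewrite /proj /coef; case: insubP => // P _ e.
by rewrite /weight_part e psi_weight_ext eqxx.
Qed.

Lemma chain_weight_part a A w :
  chain a (weight_part (size a + w) A) = weight_part w (chain a A).
Proof.
elim: a w => [|c a ih] w //=.
by rewrite addSnnS ih rder_weight_part.
Qed.

Lemma clin_chain a : clin (chain a).
Proof.
elim: a => [|c a ih] /=; first exact: clin_id.
exact: (clin_comp (clin_rder _ _ _) ih).
Qed.

Definition graded_sym (G : seq 'I_m -> O) := forall (u v : seq 'I_m) (a b : 'I_m),
  G (u ++ a :: b :: v) = ((-1) ^ (psideg edeg a * psideg edeg b) : K) *: G (u ++ b :: a :: v).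

Definition psiword (G : seq 'I_m -> O) (a : seq 'I_m) : T :=
  foldl (fun B c => smul B (psiv c)) (embed (G a)) a.

Lemma psi_mono c : psiv c = mono K tp (munit (rshift m c)).
Proof. by []. Qed.

Lemma admissible_munit n (d : 'I_n -> int) i : admissible d (munit i).
Proof. by apply/forallP => j; rewrite ffunE; case: eqP; rewrite implybT. Qed.

Lemma rder_psi c c' : dpsi c (psiv c') = (c == c')%:R *: sone K tp.
Proof.
rewrite psi_mono rder_mono ?admissible_munit // ffunE eq_rshift.
have [->|_] := eqVneq c c'; last by rewrite mulr0 !scale0r.
rewrite mulr1 /above big1 => [|j]; last first.
  by rewrite ffunE; case: eqP => [->|_ _]; rewrite ?ltnn ?mul0r.
rewrite mulr0 scale1r scale1r sone_mono; congr (mono _ _ _).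
by apply/ffunP => j; rewrite !ffunE subnn.
Qed.

Lemma parhom_psi c : parhom (~~ tpar c) (psiv c).
Proof.
move=> P; rewrite psi_mono /mono; case: (val P =P _) => [-> _|_]; last by rewrite eqxx.
by rewrite expdeg_unit par_tp_r.
Qed.

Lemma psiword_rcons G a c :
  psiword G (rcons a c) = smul (psiword (fun s => G (rcons s c)) a) (psiv c).
Proof. by rewrite /psiword foldl_rcons. Qed.

Lemma word_sum_psiword_rcons n G : word_sum n.+1 (psiword G) =
  \sum_c smul (word_sum n (psiword (fun s => G (rcons s c)))) (psiv c).
Proof.
rewrite word_sum_rcons; apply: eq_bigr => c _.
rewrite (clin_word_sum _ _ (clin_smull (psiv c))).
by apply: eq_word_sum => s _; rewrite psiword_rcons.
Qed.

Lemma graded_sym_rcons G c : graded_sym G -> graded_sym (fun s => G (rcons s c)).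
Proof. by move=> h u v a b; rewrite !rcons_cat /= h. Qed.

Lemma graded_sym_swap G s a b : graded_sym G ->
  G (rcons (rcons s a) b) = ((-1) ^+ (~~ tpar a && ~~ tpar b) : K) *: G (rcons (rcons s b) a).
Proof.
by move=> h; rewrite -!cats1 -!catA /= h sgz_par parM -!tp_r !par_tp_r.
Qed.

Lemma psiword_scale n (G G' : seq 'I_m -> O) (k : K) : (forall s, size s = n -> G s = k *: G' s) ->
  word_sum n (psiword G) = k *: word_sum n (psiword G').
Proof.
move=> h; rewrite (clin_word_sum _ _ (clin_scale k (@clin_id _ _ _))).
apply: eq_word_sum => s /h {}h; rewrite /psiword h (clinZ _ _ (@clin_embed _ _ _)).
move: (embed (G' s)) => E; elim/last_ind: s {h} => [|s x ih] //; by rewrite !foldl_rcons ih smulZl.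
Qed.

Lemma sum_delta c (W : 'I_m -> T) : \sum_b ((c == b)%:R : K) *: W b = W c.
Proof.
rewrite (bigD1 c) //= eqxx scale1r big1 ?addr0 // => b bc.
by rewrite eq_sym (negbTE bc) scale0r.
Qed.

(** The derivative hits either the last psi or, by induction, an earlier one. In the second case the
    symmetry of [G] exchanges its last two indices and absorbs the sign of passing the last psi, so
    all n + 1 positions contribute equally. Iterated, this yields the n! of [chain_psiwords]. *)
Lemma rder_psiwords n G c : graded_sym G ->
  dpsi c (word_sum n.+1 (psiword G)) = n.+1%:R *: word_sum n (psiword (fun s => G (rcons s c))).
Proof.
elim: n G c => [|n ih] G c sG.
  rewrite word_sum_psiword_rcons (clin_lsum _ _ _ (clin_rder _ _ _)) (bigD1 c) //= big1.
    rewrite addr0 (rderM _ _ (@parhom_psi c)) rder_psi eqxx scale1r smulf1.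
    by rewrite /psiword /= rder_embed smul0l scaler0 addr0 scale1r.
  move=> b bc; rewrite (rderM _ _ (@parhom_psi b)) rder_psi eq_sym (negbTE bc).
  by rewrite scale0r smul0r /psiword /= rder_embed smul0l scaler0 addr0.
rewrite word_sum_psiword_rcons (clin_lsum _ _ _ (clin_rder _ _ _)).
under eq_bigr => b _.
  rewrite (rderM _ _ (@parhom_psi b)) (ih _ _ (graded_sym_rcons b sG)).
  rewrite rder_psi smulZr smulf1 smulZl scalerA mulrC -scalerA par_tp_r -smulZl.
  rewrite -(@psiword_scale n (fun s => G (rcons (rcons s b) c))); last first.
    by move=> s _; rewrite graded_sym_swap // andbC.
  over.
rewrite big_split -scaler_sumr -(word_sum_psiword_rcons n (fun s => G (rcons s c))).
rewrite (sum_delta c (fun b => word_sum n.+1 (psiword (fun s => G (rcons s b))))).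
by rewrite -[n.+2%:R]natr1 addrC scalerDl scale1r.
Qed.

Lemma chain_rcons a c A : chain (rcons a c) A = chain a (dpsi c A).
Proof. exact: foldr_rcons. Qed.

Lemma chain_psiwords a G : graded_sym G ->
  chain a (word_sum (size a) (psiword G)) = (size a)`!%:R *: embed (G a).
Proof.
elim/last_ind: a G => [|a c ih] G sG; first by rewrite /= scale1r.
rewrite size_rcons chain_rcons rder_psiwords // (clinZ _ _ (clin_chain a)).
by rewrite (ih _ (graded_sym_rcons c sG)) scalerA factS natrM.
Qed.

(** After as many psi-derivatives as there are letters in [a], the restriction to psi = 0 sees only
    the part of that weight, and n! cancels in characteristic zero. *)
Lemma coefficients_chain A G a : [pchar K] =i pred0 -> coefficients_of A G ->
  proj (chain a A) = G a.
Proof.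
move=> cK [sG hG]; rewrite -proj_weight_part -chain_weight_part addn0 hG.
rewrite (word_sumE (size a) (psiword G)) (clinZ _ _ (clin_chain a)) chain_psiwords //.
rewrite scalerA mulVf ?scale1r ?proj_embed //.
by move/pcharf0P: cK => ->; rewrite -lt0n fact_gt0.
Qed.

End Action.

(** * Leibniz rule, skew symmetry and degree of the brackets *)

Section Brackets.
Variables (K : fieldType) (m : nat) (edeg : 'I_m -> int).
Notation td := (tdeg edeg).
Notation tp := (tpsideg edeg).
Notation O := (functionsV K edeg).
Notation T := (polyvec K edeg).
Implicit Types (f g h : O) (A B : T) (c : 'I_m) (G : seq 'I_m -> O).
Notation dpsi c := (rder (rshift m c)).
Notation tpar := (tpar edeg).

Lemma xor_cat u v : xor (u ++ v) = xor u (+) xor v.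
Proof. by elim: u => //= b u ->; rewrite addbA. Qed.

Lemma par_big (I : Type) (s : seq I) (F : I -> int) :
  par (\sum_(x <- s) F x) = xor [seq par (F x) | x <- s].
Proof.
by elim: s => [|x s ih]; rewrite ?big_nil // big_cons parD ih.
Qed.

Lemma par_sum_seq (s : seq int) : par (\sum_(x <- s) x) = xor (map par s).
Proof. exact: (par_big s id). Qed.

Lemma bracket_exponentE n (a : n.-tuple 'I_m) ds : size ds = n ->
  par (bracket_exponent edeg a ds) = word_sign edeg a (map par ds).
Proof.
elim: n a ds => [|n ih] a ds; first by rewrite tuple0 /bracket_exponent big_ord0.
case: ds => // e ds [sz]; case/tupleP: a => c a.
rewrite /bracket_exponent big_ord_recl /= big_nil addr0 mulr0 add0r.
(* Dropping the first argument, of degree [e], lowers the factor of every later t^a in the exponent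
   by e + 1. *)
transitivity (par (bracket_exponent edeg a ds + (\sum_(x <- a) td x) * (e + 1))).
  congr par; rewrite big_tuple /bracket_exponent big_distrl -big_split /=.
  by apply: eq_bigr => i _; rewrite tnthS big_cons /bump /= PoszD; ring.
rewrite !parE ih // par_big andbC; congr (_ (+) (_ && _)).
by case: (par e).
Qed.

Lemma hom_bracket_word_sum G ds fs : size ds = size fs ->
  hom_bracket G ds fs = word_sum (size fs) (fun a =>
    ((-1) ^+ word_sign edeg a (map par ds) : K) *: smul (G a) (deriv_prod a fs)).
Proof.
move=> sz; rewrite -word_sumE; apply: eq_bigr => a _.
by rewrite sgz_par bracket_exponentE.
Qed.

Variables (A : T) (G : seq 'I_m -> O).
Hypothesis chainG : forall a, proj (chain a A) = G a.

Lemma hom_bracket_acts ds fs : parhoms (map par ds) fs ->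
  hom_bracket G ds fs = ((-1) ^+ arg_sign (map par ds) : K) *: proj (acts fs A).
Proof.
move=> hp; have sz : size ds = size fs.
  rewrite -(size_map par); move: (map par ds) hp.
  by elim: (fs) => [|x s ih] [|b bs] //= [_ /ih ->].
rewrite hom_bracket_word_sum // (acts_word_sum _ hp) (clin_word_sum _ _ (@clin_proj _ _ _)).
rewrite (clin_word_sum _ _ (clin_scale _ (@clin_id _ _ _))); apply: eq_word_sum => a _.
rewrite (clinZ _ _ (@clin_proj _ _ _)) projM chainG proj_embed scalerA -signr_addb.
by rewrite [arg_sign _ (+) _]addbC -addbA addbb addbF.
Qed.

Definition parity_parts (bs : seq bool) (fs : seq O) : seq O :=
  [seq parity_part xf.1 xf.2 | xf <- zip bs fs].

Lemma parhoms_parity_parts bs fs : size bs = size fs -> parhoms bs (parity_parts bs fs).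
Proof.
elim: fs bs => [|f fs ih] [|b bs] //= [/ih h]; split=> //.
exact: parhom_parity.
Qed.

Lemma bracketE fs : bracket G fs = word_sum (size fs) (fun bs =>
  ((-1) ^+ arg_sign bs : K) *: proj (acts (parity_parts bs fs) A)).
Proof.
rewrite -word_sumE; apply: eq_bigr => bs _.
have E : map par [seq (nat_of_bool x)%:Z | x <- bs] = bs.
  by elim: (tval bs) => //= b s ->; case: b.
rewrite hom_bracket_acts E //; apply: parhoms_parity_parts; exact: size_tuple.
Qed.

Lemma act0 B : act (0 : O) B = 0.
Proof. exact: (clin0 (clin_actl B)). Qed.

(** The part of an argument in the wrong parity is zero, so only the word [bs] survives in
    [bracketE]. *)
Lemma bracket_hom bs fs : parhoms bs fs ->
  bracket G fs = ((-1) ^+ arg_sign bs : K) *: proj (acts fs A).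
Proof.
move=> h; have sz : size bs = size fs.
  by elim: fs bs h => [|x s ih] [|b bs] //= [_ /ih ->].
rewrite bracketE (word_sum1 sz).
  congr (_ *: proj (acts _ A)).
  elim: fs bs h {sz} => [|f fs ih] [|b bs] //= [hf /ih e].
  by rewrite /parity_parts /= (parity_part_hom _ hf) eqxx -[in RHS]e.
move=> s szs ne; rewrite [acts _ _](_ : _ = 0) ?(clin0 (@clin_proj _ _ _)) ?scaler0 //.
elim: fs bs s h {sz} szs ne => [|f fs ih] [|b bs] [|x s] //= [hf hfs] [szs].
rewrite eqseq_cons negb_and (parity_part_hom _ hf); case: eqP => [_ /= ne|_ _].
  by rewrite (ih _ _ hfs szs ne) (clin0 (clin_actr f)).
exact: act0.
Qed.

Lemma acts_cat us vs B : acts (us ++ vs) B = acts us (acts vs B).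
Proof. exact: foldr_cat. Qed.

Lemma parity_partP b (k : K) f g :
  parity_part b (k *: f + g) = k *: parity_part b f + parity_part b g.
Proof.
by apply: serE => p; rewrite addsE !scalesE /parity_part; case: eqP; rewrite ?mulr0 ?addr0.
Qed.

Lemma bracket_linear us vs (k : K) f g :
  bracket G (us ++ (k *: f + g) :: vs) =
    k *: bracket G (us ++ f :: vs) + bracket G (us ++ g :: vs).
Proof.
rewrite !bracketE !size_cat /=.
rewrite (clin_word_sum _ _ (clin_scale k (@clin_id _ _ _))) -word_sumD.
apply: eq_word_sum => bs sz.
have -> : acts (parity_parts bs (us ++ (k *: f + g) :: vs)) A =
    k *: acts (parity_parts bs (us ++ f :: vs)) A + acts (parity_parts bs (us ++ g :: vs)) A.
  elim: us bs sz => [|u us ih] [|b bs] //=.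
  + by rewrite parity_partP (clin_actl _).1.
  + by rewrite addSn => -[/ih e]; rewrite /parity_parts /= -/(parity_parts _ _) e (clin_actr _).1.
by rewrite (@clin_proj _ _ _).1 scalerDr !scalerA [_ * k]mulrC.
Qed.

Lemma parhoms_cat bs (us : seq O) cs (vs : seq O) : parhoms bs us -> parhoms cs vs ->
  parhoms (bs ++ cs) (us ++ vs).
Proof. by elim: us bs => [|u us ih] [|b bs] //= [hu /ih h] /h. Qed.

Lemma parhoms_homs ds (fs : seq O) : homs (@homogeneous K m td) ds fs -> parhoms (map par ds) fs.
Proof.
case; elim: fs ds => [|f fs ih] [|e ds] //= [sz] h; split.
  by apply: homogeneous_parhom; exact: (h 0%N).
by apply: ih => // i hi; exact: (h i.+1).
Qed.

(** The parity of \sum (|f_i| + 1), that is, of the operator X_(f_1) ... X_(f_n). *)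
Definition shifted_xor (bs : seq bool) := xor (map negb bs).

(** In \sum_(i < j) |f_j| (|f_i| + 1) the inserted argument occurs once in the role of f_j, with [u]
    before it, and once in the role of f_i, with [v] after it. This isolates what changes in the
    Leibniz rule and under a transposition. *)
Lemma arg_sign_cat u x v :
  arg_sign (u ++ x :: v) = arg_sign (u ++ v) (+) (x && shifted_xor u) (+) (~~ x && xor v).
Proof.
elim: u => [|b u ih] /=; first by rewrite /shifted_xor /= andbF addbF.
rewrite ih !xor_cat /= /shifted_xor /= -/(shifted_xor u).
by clear ih; case: x (arg_sign _) b (xor u) (xor v) (shifted_xor u); do 5!case.
Qed.

Lemma acts_smul_embed bs us y h B : parhoms bs us -> parhom y h ->
  acts us (smul B (embed h)) =
    ((-1) ^+ (y && shifted_xor bs) : K) *: smul (acts us B) (embed h).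
Proof.
move=> hu hh; elim: us bs hu => [|u us ih] [|b bs] //=.
  by move=> _; rewrite andbF scale1r.
move=> [hu /ih ->]; rewrite (clinZ _ _ (clin_actr _)) (act_smul_embed _ hu hh).
rewrite scalerA -signr_addb /shifted_xor /= -/(shifted_xor bs); congr (_ ^+ _ *: _).
by clear ih; case: y b (shifted_xor bs) {hu hh}; do 2!case.
Qed.

Lemma hcompP n (d : 'I_n -> int) e (k : K) (f g : series K d) :
  hcomp e (k *: f + g) = k *: hcomp e f + hcomp e g.
Proof.
by apply: serE => p; rewrite addsE !scalesE /hcomp; case: eqP; rewrite ?mulr0 ?addr0.
Qed.

Lemma hcompZ n (d : 'I_n -> int) e (k : K) (f : series K d) :
  hcomp e (k *: f) = k *: hcomp e f.
Proof.
by apply: serE => p; rewrite !scalesE /hcomp; case: eqP; rewrite ?mulr0 ?addr0.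
Qed.

Lemma homogeneous_hcomp n (d : 'I_n -> int) e (f : series K d) : homogeneous e (hcomp e f).
Proof. by move=> p; rewrite /hcomp; case: ifP => [/eqP -> //|_]; rewrite eqxx. Qed.

Lemma clin_hcomp n (d : 'I_n -> int) e : clin (fun f : series K d => hcomp e f).
Proof.
split=> [k f g|N]; first exact: hcompP.
by exists N => f v p hp; rewrite /hcomp; case: eqP => // _; exact: v.
Qed.

Lemma hcomp_mono n (d : 'I_n -> int) e p :
  hcomp e (mono K d p) = if expdeg d p == e then mono K d p else 0.
Proof.
apply: serE => q; rewrite /hcomp /mono; case: (eqVneq (val q) p) => [E|ne].
  by rewrite E; case: ifP; rewrite ?E ?eqxx.
by rewrite if_same; case: ifP; rewrite ?(negbTE ne).
Qed.

Lemma hcomp_smul n (d : 'I_n -> int) e x (f h : series K d) : homogeneous x h ->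
  hcomp e (smul f h) = smul (hcomp (e - x) f) h.
Proof.
move=> hh.
apply: (@clin_ext _ _ _ _ _ (fun u => hcomp e (smul u h)) (fun u => smul (hcomp (e - x) u) h)).
- exact: (clin_comp (clin_hcomp _ _) (clin_smull _)).
- exact: (clin_comp (clin_smull _) (clin_hcomp _ _)).
move=> p _; rewrite hcomp_mono.
apply: (@clin_ext _ _ _ _ _ (fun u => hcomp e (smul (mono K d (val p)) u))
   (fun u => smul (if expdeg d (val p) == e - x then mono K d (val p) else 0) u)).
- exact: (clin_comp (clin_hcomp _ _) (clin_smulr _)).
- exact: clin_smulr.
move=> q /hh hq; rewrite smul_mono hcompZ hcomp_mono expdegD hq.
by rewrite eq_sym -subr_eq eq_sym; case: eqP; rewrite ?smul_mono ?smul0l ?scaler0.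
Qed.

Lemma bracket_leibniz n : graded_leibniz (bracket G) n.
Proof.
move=> e dg dh ds es us vs g h _ hus hvs hg hh.
have pu := parhoms_homs hus; have pv := parhoms_homs hvs.
have pg := homogeneous_parhom hg; have ph := homogeneous_parhom hh.
have br x z : parhom z x -> bracket G (us ++ x :: vs) =
    ((-1) ^+ arg_sign (map par ds ++ z :: map par es) : K) *: proj (acts us (act x (acts vs A))).
  move=> px; rewrite (bracket_hom (bs := map par ds ++ z :: map par es)); last first.
    by apply: parhoms_cat.
  by rewrite acts_cat.
rewrite /Defs.map_comp (br _ _ (parhom_smul pg ph)) (br _ _ pg) (br _ _ ph).
set B := acts vs A; rewrite (act_smul _ pg ph) (clinD _ _ (clin_acts _)).
rewrite (clinZ _ _ (clin_acts _)) (acts_smul_embed _ pu ph) (acts_smul_embed _ pu pg).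
rewrite scalerA -signr_addb (clinD _ _ (@clin_proj _ _ _)) !(clinZ _ _ (@clin_proj _ _ _)).
rewrite !projM !proj_embed; set Fg := proj _; set Fh := proj _.
rewrite !hcompZ (clinD _ _ (clin_hcomp _ _)) !hcompZ scalerDr !scalerA -!signr_addb.
rewrite (hcomp_smul _ _ hh) (hcomp_smul _ _ hg) smulZl smulZr.
rewrite !big_cat /= !big_cons [RHS]addrC.
rewrite [in smul (hcomp _ Fh)](_ : _ - dg =
  \sum_(i <- ds) i + (dh + \sum_(j <- es) j) + e); last by ring.
rewrite [in smul (hcomp _ Fg)](_ : _ - dh =
  \sum_(i <- ds) i + (dg + \sum_(j <- es) j) + e); last by ring.
(* [act_smul] leaves both functions on the right. Moving [g] to the front past a single homogeneous
   component is what brings the degree [e] of the bracket into the sign. *)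
rewrite (smulC (homogeneous_parhom (@homogeneous_hcomp _ _ _ Fh)) pg) !scalerA.
rewrite !sgz_par -!signr_addb !parE !par_sum_seq !arg_sign_cat.
move: (arg_sign _) (shifted_xor _) (xor _) (xor _) (par dg) (par dh) (par e) => t nu xu xv.
move=> b1 b2 b3; congr (_ ^+ _ *: _ + _ ^+ _ *: _).
  by case: t; case: nu; case: xu; case: xv; case: b1; case: b2; case: b3.
by case: t; case: nu; case: xu; case: xv; case: b1; case: b2; case: b3.
Qed.

(** Commuting X_f and X_g costs (|f| + 1)(|g| + 1), and the two values of [arg_sign] differ by |f| +
    |g|; the sum has the parity of |f||g| + 1. *)
Lemma bracket_skew bs cs us vs x y f g :
  parhoms bs us -> parhoms cs vs -> parhom x f -> parhom y g ->
  bracket G (us ++ f :: g :: vs) = (- (-1) ^+ (x && y) : K) *: bracket G (us ++ g :: f :: vs).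
Proof.
move=> hu hv hf hg.
rewrite (bracket_hom (bs := bs ++ x :: y :: cs)); last exact: parhoms_cat.
rewrite (bracket_hom (bs := bs ++ y :: x :: cs)); last exact: parhoms_cat.
rewrite !acts_cat /= (act_act _ hf hg) (clinZ _ _ (clin_acts _)).
rewrite (clinZ _ _ (@clin_proj _ _ _)) !scalerA -signrN -!signr_addb; congr (_ ^+ _ *: _).
rewrite !arg_sign_cat /=.
by case: x y (arg_sign _) (shifted_xor _) (xor _) {hf hg}; do 4!case.
Qed.

Lemma homogeneous_acts ds fs e : homs (@homogeneous K m td) ds fs -> homogeneous e A ->
  homogeneous (\sum_(x <- ds) x + e - (size fs)%:Z) (acts fs A).
Proof.
case; elim: fs ds => [|f fs ih] [|x ds] //= => [_ _ hA|[sz] h hA].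
  by rewrite big_nil add0r subr0.
rewrite big_cons (_ : _ - _ = x + (\sum_(y <- ds) y + e - (size fs)%:Z) - 1); last first.
  by rewrite -addn1 PoszD; ring.
apply: homogeneous_act; first exact: (h 0%N).
by apply: ih => // i hi; exact: (h i.+1).
Qed.

Lemma homogeneous_bracket ds fs e : homs (@homogeneous K m td) ds fs -> homogeneous e A ->
  homogeneous (\sum_(x <- ds) x + e - (size fs)%:Z) (bracket G fs).
Proof.
move=> h hA; rewrite (bracket_hom (parhoms_homs h)); apply: homogeneousZ.
by apply: homogeneous_proj; exact: homogeneous_acts.
Qed.

Notation gens a := (map (gen K td) a).

Lemma homogeneous_gen c : homogeneous (td c) (gen K td c).
Proof.
move=> p; rewrite /gen -/(munit c); case: (val p =P _) => [-> _|_]; last by rewrite eqxx.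
exact: expdeg_unit.
Qed.

Lemma homs_gens a : homs (@homogeneous K m td) (map td a) (gens a).
Proof.
split=> [|i]; rewrite !size_map // => hi.
have [c0 _] : {c0 : 'I_m | True} by case: a hi => // c0; exists c0.
by rewrite !(nth_map c0) //; exact: homogeneous_gen.
Qed.

Lemma act_gen c B : act (gen K td c) B = dpsi c B.
Proof.
rewrite /act (bigD1 c) //= big1 ?addr0 => [|b bc].
  rewrite -[gen K td c]/(mono K td (munit c)) lder_mono ?admissible_munit //.
  rewrite /below big1 => [|j hj]; last first.
    by rewrite ffunE; case: eqP hj => [->|_ _]; rewrite ?ltnn ?mul0r.
  rewrite mulr0 ffunE eqxx mulr1 scale1r embed_mono.
  rewrite (_ : ext _ = [ffun=> 0%N]) -?sone_mono ?smulf1 //.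
  by apply: tp_ffunP => a; rewrite ?ext_l ?ext_r !ffunE ?subnn.
rewrite -[gen K td c]/(mono K td (munit c)) lder_mono ?admissible_munit //.
by rewrite ffunE (negbTE bc) mulr0 scale0r (clin0 (@clin_embed _ _ _)) smul0r.
Qed.

Lemma acts_gens a B : acts (gens a) B = chain a B.
Proof. by elim: a => //= c a ->; exact: act_gen. Qed.

Lemma bracket_gens a :
  bracket G (gens a) = ((-1) ^+ arg_sign (map tpar a) : K) *: proj (chain a A).
Proof.
by rewrite (bracket_hom (parhoms_homs (homs_gens a))) acts_gens -map_comp.
Qed.

End Brackets.

(** * Detecting the coefficients of a polyvector field *)

Section Coefficients.
Variables (K : fieldType) (m : nat) (edeg : 'I_m -> int).
Hypothesis charK0 : [pchar K] =i pred0.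
Notation td := (tdeg edeg).
Notation tp := (tpsideg edeg).
Notation T := (polyvec K edeg).
Implicit Types (A B : T).

(** Differentiating by each psi in a monomial, with multiplicity, moves its coefficient to a
    psi-free monomial, up to a sign and exponents that are nonzero in characteristic zero. The
    degree equation is what determines the degree of Gamma. *)
Lemma word_extract A (P : monomial tp) : A P != 0 ->
  exists (a : seq 'I_m) (q : monomial td),
    [/\ size a = psi_weight (val P), proj (chain a A) q != 0 &
        expdeg tp (val P) = expdeg td (val q) + \sum_(c <- a) psideg edeg c].
Proof.
move: {2}(psi_weight _) (erefl (psi_weight (val P))) => w.
elim: w A P => [|w ih] A P hw nz.
  have e := psi_weight0 hw.
  have aq : admissible td (tpart (val P)) by rewrite -admissible_ext -e; exact: valP P.
  exists [::], (Sub _ aq); rewrite big_nil addr0 SubK -expdeg_ext -e; split=> //.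
  by rewrite /proj SubK -e coef_val.
have [c hc] : exists c, (0 < val P (rshift m c))%N.
  apply: contrapT => H; suff : psi_weight (val P) = 0%N by rewrite hw.
  rewrite /psi_weight big1 // => c _; apply/eqP; rewrite -leqn0 leqNgt.
  by apply/negP => h; case: H; exists c.
have ap := valP P.
have aP' := admissible_pred (rshift m c) ap.
have e := mpredK hc.
have := ih (rder (rshift m c) A) (Sub _ aP'); rewrite SubK.
have hw' : psi_weight (mpred (val P) (rshift m c)) = w.
  by move: hw; rewrite {1}e psi_weightD psi_weight_unit_r addn1; case.
rewrite hw' => /(_ erefl)[|a [q [sz nq eq]]].
  rewrite /rder SubK incr_exp_madd -e coef_val sgz_par !mulf_neq0 ?signr_eq0 //.
  by move/pcharf0P: charK0 => ->.
exists (rcons a c), q; rewrite size_rcons sz hw chain_rcons nq; split=> //.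
rewrite {1}e expdegD expdeg_unit eq tp_r -cats1 big_cat /= big_cons big_nil; ring.
Qed.

End Coefficients.

(** * The Schouten bracket and its distribution over the arguments *)

Section Schouten.
Variables (K : fieldType) (m : nat) (edeg : 'I_m -> int).
Notation td := (tdeg edeg).
Notation tp := (tpsideg edeg).
Notation O := (functionsV K edeg).
Notation T := (polyvec K edeg).
Implicit Types (f : O) (A B : T) (c : 'I_m).
Notation dpsi c := (rder (rshift m c)).
Notation tpar := (tpar edeg).

Lemma clin_bulletl B : clin (fun A => bullet A B).
Proof.
apply: (@clin_sum _ _ _ _ _ _ (index_enum _) predT (fun c A => smul (dpsi c A) (lder (lshift m c) B))).
by move=> c; exact: (clin_comp (clin_smull _) (clin_rder _ _ _)).
Qed.

Lemma clin_bulletr A : clin (fun B => bullet A B).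
Proof.
apply: (@clin_sum _ _ _ _ _ _ (index_enum _) predT (fun c B => smul (dpsi c A) (lder (lshift m c) B))).
by move=> c; exact: (clin_comp (clin_smulr _) (clin_lder _ _ _)).
Qed.

(** The restriction to psi = 0 is multiplicative and commutes with t-derivatives. Through this
    identity a bracket nested in the first slot of another becomes a product A . B. *)
Lemma proj_act_proj A B : proj (act (proj B) A) = proj (bullet A B).
Proof.
rewrite /act /bullet !(clin_lsum _ _ _ (@clin_proj _ _ _)); apply: eq_bigr => c _.
by rewrite !projM proj_embed proj_lder.
Qed.

(* The part of X_f (A . B) violating the Leibniz rule; being graded symmetric in
   A and B, it cancels in the bracket. *)
Definition second_order y A B f : T :=
  \sum_c \sum_b ((-1) ^+ (tpar c && (y (+) ~~ tpar b)) : K) *: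
    smul (smul (dpsi c A) (dpsi b B)) (embed (lder c (lder b f))).

Lemma second_order_sym x y z A B f : parhom x A -> parhom y B -> parhom z f ->
  second_order y A B f = ((-1) ^+ (~~ x && ~~ y) : K) *: second_order x B A f.
Proof.
move=> hA hB hf; rewrite /second_order [in RHS]exchange_big scaler_sumr.
apply: eq_bigr => c _; rewrite scaler_sumr; apply: eq_bigr => b _.
rewrite (smulC (parhom_rder (i := rshift m b) hB) (parhom_rder (i := rshift m c) hA)).
rewrite [in RHS]lder_lder (clinZ _ _ (@clin_embed _ _ _)) smulZr smulZl !scalerA.
rewrite -!signr_addb !par_tp_r -!/(tpar _); congr (_ ^+ _ *: _).
by case: x (tpar c) (tpar b) y {hA hB}; do 3!case.
Qed.

(** In A . (X_f B) the t-derivative also falls on the derivatives of [f] inside X_f; these are the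
    only terms without a counterpart in X_f (A . B), and they form [second_order]. *)
Lemma act_bullet x y z A B f : parhom x A -> parhom y B -> parhom z f ->
  act f (bullet A B) = bullet A (act f B)
    + ((-1) ^+ (~~ z && ~~ y) : K) *: bullet (act f A) B - second_order y A B f.
Proof.
move=> hA hB hf.
have E1 : act f (bullet A B) = \sum_c \sum_b
   (smul (dpsi c A) (smul (dpsi b (lder (lshift m c) B)) (embed (lder b f))) +
    ((-1) ^+ (~~ tpar b && (y (+) tpar c)) : K) *:
    smul (dpsi b (dpsi c A)) (smul (lder (lshift m c) B) (embed (lder b f)))).
  rewrite /bullet (clin_lsum _ _ _ (clin_actr f)); apply: eq_bigr => c _.
  apply: eq_bigr => b _; rewrite (rderM _ _ (parhom_lder (i := lshift m c) hB)).
  by rewrite (clinD _ _ (clin_smull _)) smulZl !smulA par_tp_r tp_l.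
have E2 : bullet A (act f B) = \sum_c \sum_b
   (smul (dpsi c A) (smul (dpsi b (lder (lshift m c) B)) (embed (lder b f))) +
    ((-1) ^+ (tpar c && (y (+) ~~ tpar b)) : K) *:
     smul (smul (dpsi c A) (dpsi b B)) (embed (lder c (lder b f)))).
  apply: eq_bigr => c _; rewrite /act (clin_lsum _ _ _ (clin_lder _ _ _)).
  rewrite (clin_lsum _ _ _ (clin_smulr _)); apply: eq_bigr => b _.
  rewrite (lderM _ _ (parhom_rder (i := rshift m b) hB)) (clinD _ _ (clin_smulr _)).
  by rewrite smulZr [smul _ (smul (dpsi b B) _)]smulA lder_embed rder_lder_comm tp_l par_tp_r.
have E3 : bullet (act f A) B = \sum_c \sum_b
    ((-1) ^+ ((~~ tpar c && ~~ z) (+) ((z (+) tpar b) && (y (+) tpar c))) : K) *: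
    smul (dpsi b (dpsi c A)) (smul (lder (lshift m c) B) (embed (lder b f))).
  apply: eq_bigr => c _; rewrite /act (clin_lsum _ _ _ (clin_rder _ _ _)).
  rewrite (clin_lsum _ _ _ (clin_smull _)); apply: eq_bigr => b _.
  rewrite (rderM _ _ (parhom_embed (parhom_lder (i := b) hf))) rder_embed smul0r add0r.
  rewrite smulZl -smulA.
  rewrite (smulC (parhom_embed (parhom_lder (i := b) hf)) (parhom_lder (i := lshift m c) hB)).
  rewrite smulZr rder_rder smulZl !scalerA -!signr_addb !par_tp_r tp_l -!/(tpar _).
  congr (_ ^+ _ *: _).
  by case: y (tpar c) (tpar b) z {hf hB E1 E2}; do 3!case.
rewrite E1 E2 E3 /second_order scaler_sumr -big_split -sumrB; apply: eq_bigr => c _.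
rewrite scaler_sumr -big_split -sumrB; apply: eq_bigr => b _ /=.
rewrite scalerA -signr_addb addrAC addrK; congr (_ + _ ^+ _ *: _).
by case: y (tpar c) (tpar b) z {hf hB E1 E2 E3}; do 3!case.
Qed.

(* [A, B] for A and B of parities x and y *)
Definition graded_comm x y A B : T := bullet A B - ((-1) ^+ (~~ x && ~~ y) : K) *: bullet B A.

Let sign_comb1 (a b c e r s u v r1 r2 : K) : r1 = s * v -> s = u * r2 ->
  (a + u * b - s * r) - s * (c + v * e - r) = (a - r1 * e) + u * (b - r2 * c).
Proof. by move=> -> ->; ring. Qed.

Let sign_comb2 (a b c e s u v r1 r2 : K) : r1 = s * v -> s = u * r2 ->
  (a - r1 * e) + u * (b - r2 * c) = (a + u * b) - s * (c + v * e).
Proof. by move=> -> ->; ring. Qed.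

Lemma act_graded_comm x y z A B f : parhom x A -> parhom y B -> parhom z f ->
  act f (graded_comm x y A B) = graded_comm x (~~ (z (+) y)) A (act f B) +
    ((-1) ^+ (~~ z && ~~ y) : K) *: graded_comm (~~ (z (+) x)) y (act f A) B.
Proof.
move=> hA hB hf; rewrite /graded_comm (clinB _ _ (clin_actr f)) (clinZ _ _ (clin_actr f)).
rewrite (act_bullet hA hB hf) (act_bullet hB hA hf) (second_order_sym hA hB hf).
apply: serE => P; apply: (@sign_comb1 _ _ _ _ _ _ _ ((-1) ^+ (~~ z && ~~ x))).
  by rewrite -signr_addb; case: x y z {hA hB hf}; do 2!case.
by rewrite -signr_addb; case: x y z {hA hB hf}; do 2!case.
Qed.

(* The mask b marks the f_i acting on B; an f_i acting on A has to pass B, of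
   parity y, and the later marked f_j. *)
Fixpoint split_sign (b bs : seq bool) (y : bool) : bool :=
  match b, bs with
  | i :: b', p :: bs' =>
    split_sign b' bs' y (+) (~~ i && ~~ p && (~~ y (+) shifted_xor (mask b' bs')))
  | _, _ => false
  end.

Lemma shifted_xor_cat u v : shifted_xor (u ++ v) = shifted_xor u (+) shifted_xor v.
Proof. by rewrite /shifted_xor map_cat xor_cat. Qed.

(** The last argument acts first: either on [B], changing its parity, or on [A] after passing [B].
    Hence the distribution over the two factors is proved by induction from the end of the list. *)
Lemma split_sign_rcons b bs y i p : size b = size bs ->
  split_sign (rcons b i) (rcons bs p) y =
    split_sign b bs (if i then ~~ (p (+) y) else y) (+) (~~ i && ~~ p && ~~ y).
Proof.
elim: b bs => [|j b ih] [|q bs] //= => [_|[sz]].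
  by rewrite /shifted_xor /= addbF.
rewrite ih // mask_rcons // shifted_xor_cat.
clear ih; case: i; rewrite /shifted_xor /= ?addbF.
  by move: (split_sign _ _ _) (xor _); case: j; case: p; case: q; case: y; case; case.
by move: (split_sign _ _ _) (xor _); case: j; case: p; case: q; case: y; case; case.
Qed.

Definition mask_terms (b : seq bool) (fs : seq O) A B : T :=
  bullet (acts (mask (map negb b) fs) A) (acts (mask b fs) B).

Definition mask_sum (fs : seq O) bs y A B : T :=
  word_sum (size fs) (fun b => ((-1) ^+ split_sign b bs y : K) *: mask_terms b fs A B).

Lemma mask_sum_rcons fs bs f z y A B : size bs = size fs ->
  mask_sum (rcons fs f) (rcons bs z) y A B =
    mask_sum fs bs (~~ (z (+) y)) A (act f B) +
    ((-1) ^+ (~~ z && ~~ y) : K) *: mask_sum fs bs y (act f A) B.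
Proof.
move=> sz; rewrite /mask_sum size_rcons word_sum_rcons big_bool.
rewrite (clin_word_sum _ _ (clin_scale _ (@clin_id _ _ _))).
congr (_ + _); apply: eq_word_sum => b sb; rewrite split_sign_rcons ?sb // /mask_terms map_rcons.
  by rewrite !mask_rcons ?size_map ?sb //= cats0 acts_cat addbF.
rewrite !mask_rcons ?size_map ?sb //= cats0 acts_cat scalerA -signr_addb.
by congr (_ ^+ _ *: _); rewrite addbC.
Qed.

Lemma parhoms_rcons bs fs z f : parhoms (rcons bs z) (rcons fs f) ->
  parhoms bs fs /\ parhom z f.
Proof.
elim: fs bs => [|g fs ih] [|b bs] /=; [by case | by case: bs => [|? ?] [] | | ].
  by case: fs {ih} => [|? ?] [].
by case=> h /ih[].
Qed.

Lemma size_parhoms bs (fs : seq O) : parhoms bs fs -> size bs = size fs.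
Proof. by elim: fs bs => [|f fs ih] [|b bs] //= [_ /ih ->]. Qed.

(** Two independent fields of arbitrary parities are needed because the induction replaces one of
    them by its image under X_f. *)
Lemma acts_graded_comm fs bs x y A B : parhoms bs fs -> parhom x A -> parhom y B ->
  acts fs (graded_comm x y A B) = mask_sum fs bs y A B -
    ((-1) ^+ (~~ x && ~~ y) : K) *: mask_sum fs bs x B A.
Proof.
elim/last_ind: fs bs x y A B => [|fs f ih] bs x y A B.
  by case: bs => // _ _ _; rewrite /mask_sum /= !scale1r.
case/lastP: bs => [|bs z] h; first by case: fs h {ih}.
move: h => /parhoms_rcons[hs hf] hA hB.
have sz := size_parhoms hs.
rewrite -cats1 acts_cat /= (act_graded_comm hA hB hf) (clinD _ _ (clin_acts _)) (clinZ _ _ (clin_acts _)).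
rewrite (ih _ _ _ _ _ hs hA (parhom_act hf hB)) (ih _ _ _ _ _ hs (parhom_act hf hA) hB).
rewrite cats1 !mask_sum_rcons //; apply: serE => P.
apply: (@sign_comb2 _ _ _ _ _ _ ((-1) ^+ (~~ z && ~~ x))).
  by rewrite -signr_addb; case: x y z {hA hB hf}; do 2!case.
by rewrite -signr_addb; case: x y z {hA hB hf}; do 2!case.
Qed.

End Schouten.

(** * Unshuffles as masks *)

Section Inversions.
Local Open Scope nat_scope.

Lemma perm_lift n (s : 'S_n.+1) : exists s' : 'S_n, s = lift_perm ord0 (s ord0) s'.
Proof.
have ne j : s ord0 != s (lift ord0 j) by rewrite (inj_eq perm_inj) neq_lift.
pose f j := s2val (unlift_some (ne j)).
have fP j : s (lift ord0 j) = lift (s ord0) (f j) := s2valP (unlift_some (ne j)).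
have fI : injective f.
  by move=> j k e; apply: (@lift_inj _ ord0); apply: (@perm_inj _ s); rewrite !fP e.
exists (perm fI); apply/permP => i.
by case: (unliftP ord0 i) => [j|] ->; rewrite ?lift_perm_id // lift_perm_lift permE.
Qed.

(** Brings the signature to the form of [koszul_sign], a product over inversions. The first position
    starts [s ord0] of them, which is the term that [odd_lift_perm] splits off. *)
Lemma odd_inversions n (s : 'S_n) :
  odd (\sum_(i < n) \sum_(j < n) ((i < j) && (s j < s i))) = s.
Proof.
elim: n s => [|n ih] s.
  by rewrite big_ord0 (_ : s = 1%g) ?odd_perm1 //; apply/permP => -[].
have [t e] := perm_lift s; rewrite [in RHS]e odd_lift_perm /= -ih.
have c0 : \sum_(j < n.+1) ((0 < j) && (s j < s ord0)) = s ord0 :> nat.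
  rewrite big_ord_recl /= add0n.
  rewrite (eq_bigr (fun j => (t j < s ord0) : nat)) => [|j _]; last first.
    by rewrite {1}e lift_perm_lift /= /bump; lia.
  rewrite -(reindex_inj (P := xpredT) (F := fun j : 'I_n => (j < s ord0) : nat) (@perm_inj _ t)) /=.
  have le : s ord0 <= n by rewrite -ltnS.
  rewrite -[RHS]card_ord -sum1_card (big_ord_widen n (fun=> 1) le) [RHS]big_mkcond /=.
  by apply: eq_bigr => j _; case: (j < _).
rewrite big_ord_recl c0 oddD; congr (_ (+) odd _); apply: eq_bigr => i _.
rewrite big_ord_recl /= add0n; apply: eq_bigr => j _.
by rewrite {1 2}e !lift_perm_lift /= /bump; congr (nat_of_bool _); lia.
Qed.

End Inversions.

Section Unshuffle.
Local Open Scope nat_scope.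
Variable n : nat.
Implicit Types (s : nat) (sigma : 'S_n).

Let ltI : rel 'I_n := fun x y => x < y.

Lemma ltI_trans : transitive ltI.
Proof. by move=> y x z; apply: ltn_trans. Qed.

Lemma ltI_irr : irreflexive ltI.
Proof. by move=> x; apply: ltnn. Qed.

Lemma sorted_enum : sorted ltI (enum 'I_n).
Proof. by have := iota_ltn_sorted 0 n; rewrite -val_enum_ord sorted_map. Qed.

Definition word sigma := [seq sigma x | x <- enum 'I_n].

(** Marks the arguments that [sigma] sends into the inner bracket: the inverse gives the position at
    which argument [i] ends up. *)
Definition maskof s sigma : n.-tuple bool :=
  [tuple of [seq ((sigma^-1)%g i < s) | i <- ord_tuple n]].

Lemma maskofE s sigma : maskof s sigma = [seq ((sigma^-1)%g i < s) | i <- enum 'I_n] :> seq bool.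
Proof. by rewrite -val_ord_tuple. Qed.

Lemma mem_take_enum s (x : 'I_n) : (x \in take s (enum 'I_n)) = (x < s).
Proof. by rewrite in_take ?mem_enum // index_enum_ord. Qed.

Lemma mem_drop_enum s (x : 'I_n) : (x \in drop s (enum 'I_n)) = (s <= x).
Proof.
have : x \in take s (enum 'I_n) ++ drop s (enum 'I_n) by rewrite cat_take_drop mem_enum.
have : uniq (take s (enum 'I_n) ++ drop s (enum 'I_n)) by rewrite cat_take_drop enum_uniq.
rewrite mem_cat cat_uniq mem_take_enum [s <= x]leqNgt => /and3P[_ /hasPn h _].
case xs: (x < s) => //= _; apply/negbTE/negP => /h /=; by rewrite mem_take_enum xs.
Qed.

Lemma mem_map_perm sigma (t : seq 'I_n) x : (x \in map sigma t) = ((sigma^-1)%g x \in t).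
Proof. by rewrite -{1}(permKV sigma x) (mem_map (@perm_inj _ sigma)). Qed.

Lemma unshuffleP s sigma (i j : 'I_n) : unshuffle s sigma ->
  i < j -> (j < s) || (s <= i) -> sigma i < sigma j.
Proof. by move=> /forallP/(_ i)/forallP/(_ j)/implyP h ij js; apply: h; rewrite ij. Qed.

(** Both sides are strictly increasing and have the same elements. *)
Lemma take_word s sigma : unshuffle s sigma ->
  take s (word sigma) = mask (maskof s sigma) (enum 'I_n).
Proof.
move=> us; rewrite maskofE -filter_mask -map_take.
apply: (irr_sorted_eq ltI_trans ltI_irr).
- apply: (homo_sorted_in (P := [pred x : 'I_n | x < s]) (e := ltI)).
  + by move=> i j _ js ij; apply: (unshuffleP us ij); rewrite [j < s]js.
  + by apply/allP => x; rewrite mem_take_enum.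
  + exact: take_sorted sorted_enum.
- exact: (sorted_filter ltI_trans _ sorted_enum).
- by move=> x; rewrite mem_map_perm mem_take_enum mem_filter mem_enum andbT.
Qed.

Lemma drop_word s sigma : unshuffle s sigma ->
  drop s (word sigma) = mask (map negb (maskof s sigma)) (enum 'I_n).
Proof.
move=> us; rewrite maskofE -map_comp -filter_mask -map_drop.
apply: (irr_sorted_eq ltI_trans ltI_irr).
- apply: (homo_sorted_in (P := [pred x : 'I_n | s <= x]) (e := ltI)).
  + by move=> i j si _ ij; apply: (unshuffleP us ij); rewrite [s <= i]si orbT.
  + by apply/allP => x; rewrite mem_drop_enum.
  + exact: drop_sorted sorted_enum.
- exact: (sorted_filter ltI_trans _ sorted_enum).
- by move=> x; rewrite mem_map_perm mem_drop_enum mem_filter mem_enum andbT /= leqNgt.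
Qed.

Lemma word_inj : injective word.
Proof.
move=> s t /eq_in_map h; apply/permP => i; apply: h; exact: mem_enum.
Qed.

Definition mask_word (b : seq bool) := mask b (enum 'I_n) ++ mask (map negb b) (enum 'I_n).

Lemma perm_mask_word (b : n.-tuple bool) : perm_eq (mask_word b) (enum 'I_n).
Proof.
have : size b = size (enum 'I_n) by rewrite size_tuple size_enum_ord.
rewrite /mask_word; elim: (tval b) (enum _) => [|[] u ih] [|x t] //= [/ih h].
  by rewrite perm_cons.
by rewrite -cat1s perm_catCA /= perm_cons.
Qed.

Lemma mask_perm_proof (b : n.-tuple bool) : injective (fun i : 'I_n => nth i (mask_word b) i).
Proof.
have sz : size (mask_word b) = n by rewrite (perm_size (perm_mask_word b)) size_enum_ord.
have u : uniq (mask_word b) by rewrite (perm_uniq (perm_mask_word b)) enum_uniq.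
move=> i j /eqP; rewrite (set_nth_default i) ?sz // nth_uniq ?sz // => /eqP.
exact: val_inj.
Qed.

(** Inverse to [maskof]: an unshuffle is determined by the set it moves to the front. Masks, unlike
    permutations, admit recursion along the list of arguments. *)
Definition mask_perm (b : n.-tuple bool) : 'S_n := perm (@mask_perm_proof b).

Lemma word_mask_perm (b : n.-tuple bool) : word (mask_perm b) = mask_word b.
Proof.
have sz : size (mask_word b) = n by rewrite (perm_size (perm_mask_word b)) size_enum_ord.
case: (posnP n) => [n0|n0].
  by rewrite [LHS]size0nil ?[RHS]size0nil ?sz // size_map size_enum_ord.
pose x0 := Ordinal n0.
apply: (@eq_from_nth _ x0) => [|i]; rewrite size_map size_enum_ord ?sz // => hi.
rewrite (nth_map x0) ?size_enum_ord // permE.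
rewrite (_ : nth x0 (enum 'I_n) i = Ordinal hi); last first.
  by apply: val_inj; rewrite /= nth_enum_ord.
by apply: set_nth_default; rewrite sz.
Qed.

Lemma mask_permK s sigma : unshuffle s sigma -> mask_perm (maskof s sigma) = sigma.
Proof.
move=> us; apply: word_inj; rewrite word_mask_perm /mask_word.
by rewrite -take_word // -drop_word // cat_take_drop.
Qed.

Lemma size_mask_enum (b : n.-tuple bool) : size (mask b (enum 'I_n)) = count id b.
Proof. by rewrite size_mask // size_tuple size_enum_ord. Qed.

Lemma count_maskof s sigma : s <= n -> unshuffle s sigma -> count id (maskof s sigma) = s.
Proof.
move=> sn us; rewrite -size_mask_enum -take_word // size_takel // size_map.
by rewrite size_enum_ord.
Qed.

Lemma unshuffle_mask_perm s (b : n.-tuple bool) : count id b = s -> unshuffle s (mask_perm b).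
Proof.
move=> cb; apply/forallP => i; apply/forallP => j; apply/implyP => /andP[ij h].
have sz : size (mask_word b) = n by rewrite (perm_size (perm_mask_word b)) size_enum_ord.
rewrite !permE (set_nth_default i j) ?sz // /mask_word !nth_cat size_mask_enum cb.
have sm (c : seq bool) : sorted ltI (mask c (enum 'I_n)).
  exact: (sorted_mask ltI_trans c sorted_enum).
case/orP: h => h.
  rewrite h (ltn_trans ij h); apply: (sorted_ltn_nth ltI_trans i (sm b)) => //;
  by rewrite inE size_mask_enum cb // (ltn_trans ij h).
have sj : s <= j by apply: leq_trans h (ltnW ij).
rewrite (ltnNge i s) (ltnNge j s) h sj /=; apply: (sorted_ltn_nth ltI_trans i (sm _)).
+ rewrite inE; move: sz; rewrite size_cat size_mask_enum cb => sz.
  by rewrite ltn_subLR // sz.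
+ rewrite inE; move: sz; rewrite size_cat size_mask_enum cb => sz.
  by rewrite ltn_subLR // sz.
+ by rewrite ltn_sub2r // (leq_ltn_trans h ij).
Qed.

Lemma maskof_mask_perm s (b : n.-tuple bool) : count id b = s -> maskof s (mask_perm b) = b.
Proof.
move=> cb; have us := unshuffle_mask_perm cb; have := take_word us.
rewrite word_mask_perm /mask_word take_cat size_mask_enum cb ltnn subnn take0 cats0 => e.
apply: val_inj; apply: (@eq_from_nth _ false) => [|i]; rewrite !size_tuple // => hi.
have := congr1 (fun t => Ordinal hi \in t) e.
rewrite !in_mask ?enum_uniq // mem_enum /= index_enum_ord /= => ->.
by [].
Qed.

Lemma sum_unshuffles (R : nmodType) s (F : 'S_n -> R) : s <= n ->
  (\sum_(sigma : 'S_n | unshuffle s sigma) F sigma =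
   \sum_(b : n.-tuple bool | count id b == s) F (mask_perm b))%R.
Proof.
move=> sn; rewrite (reindex_onto mask_perm (maskof s)); last by move=> t; exact: mask_permK.
apply: eq_bigl => b; apply/andP/eqP => [[us /eqP e]|cb].
  by rewrite -e count_maskof.
by rewrite unshuffle_mask_perm // maskof_mask_perm.
Qed.

End Unshuffle.

(* Koszul sign times signature of the unshuffle that moves the entries marked by
   the mask to the front, for arguments of parities bs *)
Fixpoint mask_koszul (b bs : seq bool) : bool :=
  match b, bs with
  | i :: b', p :: bs' =>
    mask_koszul b' bs' (+)
      (~~ i && (odd (size (mask b' bs')) (+) (p && xor (mask b' bs'))))
  | _, _ => false
  end.

(** * The sign of an unshuffle in terms of its mask *)

Section KoszulSign.
Variable K : fieldType.

(** The exponent [~~ (p x && q)] stands for -(-1)^(pq), the Koszul sign times the signature of one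
    exchanged pair. The product is the contribution of an unmarked argument of parity [q] that
    precedes all the others. *)
Lemma prod_first n (beta p : 'I_n -> bool) (q : bool) :
  \prod_(x < n | beta x) ((-1) ^+ (~~ (p x && q)) : K) =
  (-1) ^+ (odd (size (mask (map beta (enum 'I_n)) (map p (enum 'I_n)))) (+)
           (q && xor (mask (map beta (enum 'I_n)) (map p (enum 'I_n))))).
Proof.
elim: n beta p => [|n ih] beta p.
  by rewrite big_ord0 (size0nil (size_enum_ord 0)) /= andbF.
rewrite big_mkcond big_ord_recl -big_mkcond /= (ih (beta \o lift ord0) (p \o lift ord0)).
rewrite enum_ordSl /= -!map_comp.
move: (mask _ _) => u; case: (beta ord0); last by rewrite mul1r.
rewrite -signr_addb /=; congr (_ ^+ _).
by clear ih; case: (odd _) (xor _) (p ord0) q; do 3!case.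
Qed.

Lemma prod_mask_koszul n (beta p : 'I_n -> bool) :
  \prod_(x < n) \prod_(y < n | [&& (y < x)%N, beta x & ~~ beta y])
     ((-1) ^+ (~~ (p x && p y)) : K) =
  (-1) ^+ mask_koszul (map beta (enum 'I_n)) (map p (enum 'I_n)).
Proof.
elim: n beta p => [|n ih] beta p.
  by rewrite big_ord0 (size0nil (size_enum_ord 0)).
rewrite enum_ordSl /= -(map_comp beta (lift ord0)) -(map_comp p (lift ord0)).
rewrite signr_addb -(ih (beta \o lift ord0) (p \o lift ord0)) big_ord_recl.
rewrite [X in X * _]big1 => [|//]; rewrite mul1r.
transitivity (\prod_(x < n) ((if beta (lift ord0 x) && ~~ beta ord0 then
    (-1) ^+ (~~ (p (lift ord0 x) && p ord0)) else 1) *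
    \prod_(y < n | [&& (y < x)%N, beta (lift ord0 x) & ~~ beta (lift ord0 y)])
     ((-1) ^+ (~~ (p (lift ord0 x) && p (lift ord0 y))) : K))).
  apply: eq_bigr => x _; rewrite big_mkcond big_ord_recl /=; congr (_ * _).
  by rewrite [RHS]big_mkcond; apply: eq_bigr.
rewrite big_split mulrC; congr (_ * _); case: (beta ord0) => /=.
  by rewrite expr0 big1 // => x _; rewrite andbF.
rewrite -(prod_first (beta \o lift ord0) (p \o lift ord0)) [RHS]big_mkcond.
by apply: eq_bigr => x _; rewrite andbT.
Qed.

Lemma koszul_mask_perm n (dv : 'I_n -> int) (b : n.-tuple bool) :
  koszul_sign K dv (mask_perm b) * (-1) ^+ (mask_perm b) =
  (-1) ^+ mask_koszul b [seq par (dv x) | x <- enum 'I_n].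
Proof.
set s := count id b; have us := unshuffle_mask_perm (erefl s).
have ms := maskof_mask_perm (erefl s); set sigma := mask_perm b in us ms *.
rewrite -[in RHS]ms maskofE -prod_mask_koszul -odd_inversions signr_odd.
rewrite -prodrXr -big_split /=.
rewrite (reindex_inj (@perm_inj _ (sigma^-1)%g)) /=; apply: eq_bigr => x _.
rewrite permKV -prodrXr big_mkcond -big_split [RHS]big_mkcond /=.
rewrite (reindex_inj (@perm_inj _ (sigma^-1)%g)) /=; apply: eq_bigr => y _.
rewrite permKV; have [yx|yx] := boolP (y < x)%N; last by rewrite andbF mul1r.
rewrite andbT /=.
(* An unshuffle keeps the order within each block, so its inversions are the pairs of an unmarked
   argument followed by a marked one. *)
have -> : ((sigma^-1)%g x < (sigma^-1)%g y)%N =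
    ((sigma^-1)%g x < s)%N && ~~ ((sigma^-1)%g y < s)%N.
  apply/idP/andP => [xy|[xs]]; last by rewrite -leqNgt; apply: leq_trans.
  have H : ~ ((((sigma^-1)%g y < s) || (s <= (sigma^-1)%g x))%N).
    move=> h; have := unshuffleP us xy h; rewrite !permKV; lia.
  by split; [rewrite ltnNge; apply/negP => h; apply: H; rewrite h orbT
            | apply/negP => h; apply: H; rewrite h].
case: (_ && _); last by rewrite mulr1.
by rewrite sgz_par parM expr1 signrN mulrN1.
Qed.

End KoszulSign.

(** On the left stand the signs of one term of the relation: the unshuffle, the arguments of the
    inner and of the outer bracket, the inner bracket as first argument of the outer one, and
    (-1)^(r - 1). On the right stands the sign of the same term in the distribution of the X_(f_i),
    up to [arg_sign bs], which does not depend on the mask. *)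
Lemma mask_sign b bs : size b = size bs ->
  mask_koszul b bs (+) arg_sign (mask b bs) (+) arg_sign (mask (map negb b) bs) (+)
    (~~ shifted_xor (mask b bs) && xor (mask (map negb b) bs)) (+)
    odd (size (mask (map negb b) bs)) =
  split_sign b bs false (+) arg_sign bs.
Proof.
have nsumE u : shifted_xor u = xor u (+) odd (size u).
  elim: u => //= p u ih; rewrite /shifted_xor /= -/(shifted_xor u) ih.
  by case: p (xor u) (odd _); do 2!case.
elim: b bs => [|i b ih] [|p bs] //= [sz].
have E : xor bs = xor (mask b bs) (+) xor (mask (map negb b) bs).
  elim: b bs sz {ih} => [|j b ih] [|q bs] //= [/ih ->].
  by case: j => /=; case: q (xor _) (xor _); do 2!case.
move: (ih _ sz); rewrite E !nsumE.
move: (mask b bs) (mask (map negb b) bs) => u v; clear.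
case: i => /=; move: (mask_koszul _ _) (split_sign _ _ _) (arg_sign bs) (arg_sign u) (arg_sign v) (xor u)
    (xor v) (odd (size u)) (odd (size v)); case: p; do 9!case; by [].
Qed.

(** Levels start at 1 and powers of hbar at 0, so the levels with sum k + 2 give the coefficient of
    hbar^k. The vanishing beyond the arities removes the bounds on [i] and [j]. *)
Lemma sum_shifted (V : nmodType) (F : nat -> nat -> V) r s k :
  (forall i j, (r < i)%N -> F i j = 0) -> (forall i j, (s < j)%N -> F i j = 0) ->
  \sum_(1 <= i < r.+1) \sum_(1 <= j < s.+1 | (i + j == k.+2)%N) F i j =
  \sum_(i < k.+1) F i.+1 (k - i).+1.
Proof.
move=> hr hs.
transitivity (\sum_(1 <= i < k.+2) F i (k.+2 - i)%N); last first.
  rewrite big_add1 /= big_mkord; apply: eq_bigr => i _; congr (F _ _).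
  have := ltn_ord i; lia.
transitivity (\sum_(1 <= i < r.+1) if (i < k.+2)%N then F i (k.+2 - i)%N else 0).
  apply: eq_big_nat => i /andP[i1 ir]; case: ifP => ik; last first.
    by rewrite big_nat_cond big1 // => j; lia.
  transitivity (\sum_(1 <= j < s.+1 | j == (k.+2 - i)%N) F i j).
    by apply: eq_bigl => j; lia.
  rewrite big_nat1_eq; case: ifP => // h; rewrite hs //; lia.
rewrite (big_nat_widen _ _ (maxn r.+1 k.+2)) ?leq_maxl //.
rewrite [RHS](big_nat_widen _ _ (maxn r.+1 k.+2)) ?leq_maxr //.
rewrite big_mkcond [RHS]big_mkcond; apply: eq_bigr => i _ /=.
case: ifP => // ir; case: ifP => // ik; rewrite hr //; lia.
Qed.

Lemma sum_antidiagonal (V : nmodType) (F : nat -> V) n :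
  \sum_(1 <= r < n.+1) \sum_(1 <= s < n.+1 | (r + s == n.+1)%N) F s =
  \sum_(1 <= s < n.+1) F s.
Proof.
transitivity (\sum_(1 <= r < n.+1) F (n.+1 - r)%N).
  apply: eq_big_nat => r hr.
  transitivity (\sum_(1 <= s < n.+1 | s == (n.+1 - r)%N) F s).
    by apply: eq_bigl => s; lia.
  by rewrite big_nat1_eq ifT //; lia.
rewrite [RHS]big_nat_rev; apply: eq_big_nat => r hr; congr F; lia.
Qed.

(** The relations start at s = 1, so the mask marking nothing must contribute zero. *)
Lemma sum_by_count (V : nmodType) n (F : n.-tuple bool -> V) :
  (forall b : n.-tuple bool, count id b = 0%N -> F b = 0) ->
  \sum_(1 <= s < n.+1) \sum_(b : n.-tuple bool | count id b == s) F b = \sum_b F b.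
Proof.
move=> h; rewrite (exchange_big_dep predT) //=; apply: eq_bigr => b _.
transitivity (\sum_(1 <= s < n.+1 | s == count id b) F b).
  by apply: eq_bigl => s; rewrite eq_sym.
rewrite big_nat1_eq; case: ifP => // hc; rewrite h //.
have := count_size id b; rewrite size_tuple; lia.
Qed.

Lemma size_mask_negb (T : Type) (b : seq bool) (t : seq T) : size t = size b ->
  size (mask (map negb b) t) = (size b - count id b)%N.
Proof.
elim: b t => [|i b ih] [|x t] //= [/ih e].
by have := count_size id b; case: i => /=; rewrite e; lia.
Qed.

(** * The Jacobi relations *)

Section Weights.
Variables (K : fieldType) (m : nat) (edeg : 'I_m -> int).
Notation T := (polyvec K edeg).
Notation O := (functionsV K edeg).
Implicit Types (A B : T) (f : O) (c : 'I_m).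

Lemma weight_ge_rder w c A : weight_ge w.+1 A -> weight_ge w (rder (rshift m c) A).
Proof.
move=> h P /rder_support[Q /h le e].
by rewrite e psi_weightD psi_weight_unit_r addn1 in le.
Qed.

Lemma weight_ge_lder w c A : weight_ge w A -> weight_ge w (lder (lshift m c) A).
Proof.
move=> h P /lder_support[Q /h le e].
by rewrite e psi_weightD psi_weight_unit_l addn0 in le.
Qed.

Lemma weight_ge_smul w w' A B : weight_ge w A -> weight_ge w' B ->
  weight_ge (w + w') (smul A B).
Proof.
move=> hA hB P /smul_support[Q [R [/hA h1 /hB h2 ->]]].
by rewrite psi_weightD leq_add.
Qed.

Lemma weight_ge_sum w (I : Type) (s : seq I) (F : I -> T) :
  (forall x, weight_ge w (F x)) -> weight_ge w (\sum_(x <- s) F x).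
Proof.
move=> h; elim: s => [|x s ih] P; first by rewrite big_nil zerosE eqxx.
rewrite big_cons addsE; case: (eqVneq (F x P) 0) => [->|/h //].
by rewrite add0r => /ih.
Qed.

Lemma weight_geD w A B : weight_ge w A -> weight_ge w B -> weight_ge w (A + B).
Proof.
move=> hA hB P; rewrite addsE; case: (eqVneq (A P) 0) => [->|/hA //].
by rewrite add0r => /hB.
Qed.

Lemma weight_ge_act w f A : weight_ge w.+1 A -> weight_ge w (act f A).
Proof.
move=> h; apply: weight_ge_sum => c; rewrite -[w]addn0.
by apply: weight_ge_smul => //; apply: weight_ge_rder.
Qed.

Lemma weight_ge_acts w fs A : weight_ge (size fs + w) A -> weight_ge w (acts fs A).
Proof.
elim: fs w => [|f fs ih] w //= h.
by apply: weight_ge_act; apply: ih; rewrite addnS.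
Qed.

Lemma weight_ge_bullet w w' A B : weight_ge w.+1 A -> weight_ge w' B ->
  weight_ge (w + w') (bullet A B).
Proof.
move=> hA hB; apply: weight_ge_sum => c.
by apply: weight_ge_smul; [apply: weight_ge_rder | apply: weight_ge_lder].
Qed.

Lemma weight_geW w w' A : (w' <= w)%N -> weight_ge w A -> weight_ge w' A.
Proof. by move=> le h P /h; apply: leq_trans. Qed.

Lemma proj_weight_ge A : weight_ge 1 A -> proj A = 0.
Proof.
move=> h; apply: serE => p; rewrite zerosE /proj; apply/eqP/negPn/negP.
by move=> /coef_support[P /h le e]; rewrite e psi_weight_ext in le.
Qed.

Lemma proj_bullet_weight_ge A B : weight_ge 2 A -> proj (bullet A B) = 0.
Proof.
move=> h; rewrite /bullet (clin_lsum _ _ _ (@clin_proj _ _ _)) big1 // => c _.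
by rewrite projM proj_weight_ge ?smul0l //; apply: weight_ge_rder.
Qed.

Lemma proj_bullet_proj0 A B : proj B = 0 -> proj (bullet A B) = 0.
Proof. by rewrite -proj_act_proj => ->; rewrite act0 (clin0 (@clin_proj _ _ _)). Qed.

End Weights.

Section MaskParities.
Variables (K : fieldType) (m : nat) (edeg : 'I_m -> int).
Notation O := (functionsV K edeg).

Lemma parhoms_mask b bs (fs : seq O) : parhoms bs fs -> parhoms (mask b bs) (mask b fs).
Proof.
elim: fs bs b => [|f fs ih] [|x bs] [|i b] //= [hf /ih h].
by case: i => /=; [split=> //; exact: h | exact: h].
Qed.

Lemma parhom_acts y bs (fs : seq O) (A : polyvec K edeg) : parhoms bs fs -> parhom y A ->
  parhom (shifted_xor bs (+) y) (acts fs A).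
Proof.
move=> h hA; elim: fs bs h => [|f fs ih] [|b bs] //= [hf /ih h].
have -> : shifted_xor (b :: bs) (+) y = ~~ (b (+) (shifted_xor bs (+) y)).
  by rewrite /shifted_xor /= -/(shifted_xor bs); case: (b) (shifted_xor bs) (y); do 2!case.
exact: (parhom_act hf h).
Qed.

End MaskParities.

Section Jacobi.
Variables (K : fieldType) (m : nat) (edeg : 'I_m -> int).
Variables (Gamma : nat -> polyvec K edeg) (G : nat -> seq 'I_m -> functionsV K edeg).
Hypothesis Gamma_weight : forall k, weight_ge k.+1 (Gamma k).
Hypothesis chainG : forall k a, proj (chain a (Gamma k)) = G k a.
Hypothesis Gamma_deg : forall k, homogeneous 2 (Gamma k).
Notation O := (functionsV K edeg).
Notation td := (tdeg edeg).

Definition signed_bracket (k : nat) (fs : seq O) : O := (-1) ^+ 'C(size fs, 2) *: Lbr G k fs.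

Lemma Gamma_even k : parhom false (Gamma k).
Proof. exact: homogeneous_parhom (Gamma_deg (k := k)). Qed.

(** As Gamma is even, the inner bracket has parity \sum (|f_i| + 1) over its arguments. It is the
    outermost X in the outer bracket, so [proj_act_proj] applies. *)
Lemma signed_bracket_nested b bs fs i j : parhoms bs fs ->
  signed_bracket i (signed_bracket j (mask b fs) :: mask (map negb b) fs) =
  ((-1) ^+ (odd 'C((size (mask (map negb b) bs)).+1, 2) (+) odd 'C(size (mask b bs), 2) (+)
     arg_sign (mask b bs) (+) arg_sign (mask (map negb b) bs) (+)
    (~~ shifted_xor (mask b bs) && xor (mask (map negb b) bs))) : K) *:
  proj (mask_terms b fs (Gamma i.-1) (Gamma j.-1)).
Proof.
move=> h; have h1 := parhoms_mask b h; have h2 := parhoms_mask (map negb b) h.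
have hF : parhom (shifted_xor (mask b bs)) (signed_bracket j (mask b fs)).
  apply: parhomZ; rewrite /Lbr (bracket_hom (chainG _) h1); apply: parhomZ.
  by apply: parhom_proj; rewrite -[shifted_xor _]addbF; apply: parhom_acts => //; exact: Gamma_even.
rewrite {1}/signed_bracket /Lbr (bracket_hom (chainG _) (bs := shifted_xor (mask b bs) :: mask (map negb b) bs)) //.
rewrite /= /signed_bracket /Lbr (bracket_hom (chainG _) h1) scalerA 2!(clinZ _ _ (clin_actl _)) /=.
rewrite !(clinZ _ _ (@clin_proj _ _ _)) proj_act_proj !scalerA.
rewrite -(size_parhoms h1) -(size_parhoms h2) -!(signr_odd _ 'C(_, _)) -!signr_addb.
congr (_ ^+ _ *: _).
by move: (odd _) (odd _) (arg_sign _) (arg_sign _) (shifted_xor _) (xor _); do 6!case.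
Qed.

(** From C(r + s, 2) = C(r, 2) + C(s, 2) + rs: the rescaling replaces the sign exponent r (s - 1) by
    r, up to a sign depending on [n] only. *)
Lemma bin2_sign r s n : (r + s = n.+1)%N -> (0 < s)%N ->
  odd 'C(r, 2) (+) odd 'C(s, 2) (+) odd (r * (s - 1)) = odd 'C(n.+1, 2) (+) odd r.
Proof.
move=> <- s0; have -> : 'C(r + s, 2) = ('C(r, 2) + 'C(s, 2) + r * s)%N.
  elim: s {s0} => [|s ih]; first by rewrite bin0n muln0 !addn0.
  by rewrite addnS !binS !bin1 ih mulnS; lia.
rewrite !oddD (_ : odd (r * s) = odd (r * (s - 1)) (+) odd r); last first.
  by rewrite -oddD -{3}[r]muln1 -mulnDr subnK.
by move: (odd _) (odd _) (odd _) (odd _); do 4!case.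
Qed.

Lemma jacobi_sum n k (dv : 'I_n -> int) (v : 'I_n -> O) :
  (forall i, homogeneous (dv i) (v i)) ->
  let fs := [seq v x | x <- enum 'I_n] in
  let bs := [seq par (dv x) | x <- enum 'I_n] in
  \sum_(1 <= r < n.+1) \sum_(1 <= s < n.+1 | (r + s == n.+1)%N)
  \sum_(1 <= i < r.+1) \sum_(1 <= j < s.+1 | (i + j == k.+2)%N)
  \sum_(sigma : 'S_n | unshuffle s sigma)
    (let w := [seq v (sigma x) | x <- enum 'I_n] in
    (koszul_sign K dv sigma * (-1) ^+ sigma * (-1) ^+ (r * (s - 1)))
      *: signed_bracket i (signed_bracket j (take s w) :: drop s w)) =
  ((-1) ^+ (~~ odd 'C(n.+1, 2) (+) arg_sign bs) : K) *:
  proj (\sum_(i < k.+1) mask_sum fs bs false (Gamma i) (Gamma (k - i)%N)).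
Proof.
move=> hv fs bs.
have hfs : parhoms bs fs.
  by rewrite /bs /fs; elim: (enum _) => //= x t ih; split=> //; apply: homogeneous_parhom.
pose X (b : seq bool) i j : O := ((-1) ^+ split_sign b bs false : K) *:
  proj (mask_terms b fs (Gamma i.-1) (Gamma j.-1)).
(* The sign common to all terms. The negation arises because [bin2_sign] leaves the parity of r
   while [mask_sign] contains that of r - 1. *)
pose c : K := (-1) ^+ (~~ odd 'C(n.+1, 2) (+) arg_sign bs).
have szb : size bs = n by rewrite size_map size_enum_ord.
have szf : size fs = n by rewrite size_map size_enum_ord.
pose Z b := \sum_(i < k.+1) X b i.+1 (k - i).+1.
have termE (b : n.-tuple bool) r s i j : (r + s = n.+1)%N -> count id b = s -> (0 < s)%N ->
    (let w := [seq v (mask_perm b x) | x <- enum 'I_n] in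
    (koszul_sign K dv (mask_perm b) * (-1) ^+ mask_perm b * (-1) ^+ (r * (s - 1)))
      *: signed_bracket i (signed_bracket j (take s w) :: drop s w)) = c *: X b i j.
  move=> rs cb s0 /=; have us := unshuffle_mask_perm cb.
  have -> : [seq v (mask_perm b x) | x <- enum 'I_n] = map v (word (mask_perm b)).
    by rewrite /word -(map_comp v (mask_perm b)).
  rewrite -map_take -map_drop take_word // drop_word // maskof_mask_perm //.
  rewrite !map_mask -/fs (signed_bracket_nested _ _ _ hfs) koszul_mask_perm -/bs /X !scalerA /c.
  rewrite -[(-1) ^+ (r * _)]signr_odd -!signr_addb; congr (_ ^+ _ *: _).
  have s1 : size (mask b bs) = s by rewrite size_mask ?szb ?size_tuple.
  have s2 : size (mask (map negb b) bs) = r.-1.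
    by rewrite size_mask_negb ?szb ?size_tuple //; rewrite cb; lia.
  have sn : (s <= n)%N by have := count_size id b; rewrite size_tuple cb.
  have r0 : (0 < r)%N by lia.
  have sgn := @mask_sign b bs; rewrite size_tuple szb s2 in sgn.
  have := bin2_sign rs s0; rewrite s1 s2 prednK //.
  have od : odd r.-1 = ~~ odd r by lia.
  move: (sgn erefl); rewrite od.
  move: (mask_koszul _ _) (odd (r * _)) (odd r) (odd 'C(r, 2)) (odd 'C(s, 2)) (odd 'C(n.+1, 2)).
  move: (arg_sign (mask b bs)) (arg_sign (mask (map negb b) bs)) (_ && _) (arg_sign bs) (split_sign _ _ _).
  move=> t1 t2 x t g h o p c1 c2 c3 e1 e2.
  have -> : t = g (+) (h (+) t1 (+) t2 (+) x (+) ~~ p) by rewrite e1 addKb.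
  have -> : c3 = (c1 (+) c2 (+) o) (+) p by rewrite e2 -addbA addbb addbF.
  by move: h o p c1 c2 t1 t2 x g {e1 e2}; do 9!case.
have X0 (b : n.-tuple bool) r s : (r + s = n.+1)%N -> count id b = s ->
    \sum_(1 <= i < r.+1) \sum_(1 <= j < s.+1 | (i + j == k.+2)%N) X b i j = Z b.
  move=> rs cb; have sn : (s <= n)%N by have := count_size id b; rewrite size_tuple cb.
  (* For i > r, the r - 1 outer arguments leave at least two psi on Gamma, one more than the
     derivative in the product A . B removes. For j > s, the s inner arguments leave at least one
     psi, which the restriction to psi = 0 kills. *)
  apply: sum_shifted => i j h; rewrite /X /mask_terms.
    rewrite proj_bullet_weight_ge ?scaler0 //; apply: weight_ge_acts.
    apply: weight_geW (Gamma_weight (k := i.-1)).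
    by rewrite size_mask_negb ?szf ?size_tuple //; rewrite cb; lia.
  rewrite proj_bullet_proj0 ?scaler0 //; apply: proj_weight_ge; apply: weight_ge_acts.
  apply: weight_geW (Gamma_weight (k := j.-1)).
  by rewrite size_mask ?szf ?size_tuple //; rewrite cb; lia.
transitivity (\sum_(1 <= r < n.+1) \sum_(1 <= s < n.+1 | (r + s == n.+1)%N)
    \sum_(b : n.-tuple bool | count id b == s) c *: Z b).
  apply: eq_big_nat => r hr; rewrite big_nat_cond [RHS]big_nat_cond.
  apply: eq_bigr => s /andP[hs /eqP rs].
  transitivity (\sum_(1 <= i < r.+1) \sum_(1 <= j < s.+1 | (i + j == k.+2)%N)
      \sum_(b : n.-tuple bool | count id b == s) c *: X b i j).
    apply: eq_bigr => i _; apply: eq_bigr => j _; rewrite sum_unshuffles; last by lia.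
    by apply: eq_bigr => b /eqP cb; apply: termE => //; lia.
  transitivity (\sum_(b : n.-tuple bool | count id b == s)
      \sum_(1 <= i < r.+1) \sum_(1 <= j < s.+1 | (i + j == k.+2)%N) c *: X b i j).
    rewrite [RHS]exchange_big; apply: eq_bigr => i _; exact: exchange_big.
  apply: eq_bigr => b /eqP cb; rewrite -(X0 b r s rs cb) scaler_sumr.
  by apply: eq_bigr => i _; rewrite scaler_sumr.
rewrite (sum_antidiagonal (fun s => \sum_(b : n.-tuple bool | count id b == s) c *: Z b)).
(* With nothing marked, the second factor is a component of Gamma itself, which has a factor psi. *)
rewrite sum_by_count => [|b cb]; last first.
  rewrite /Z big1 ?scaler0 // => i _; rewrite /X /mask_terms proj_bullet_proj0 ?scaler0 //.
  apply: proj_weight_ge; apply: weight_ge_acts; apply: weight_geW (Gamma_weight (k := _)).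
  by rewrite size_mask ?szf ?size_tuple //; rewrite cb.
rewrite -scaler_sumr -/c; congr (_ *: _).
rewrite (clin_lsum _ _ _ (@clin_proj _ _ _)) /Z exchange_big; apply: eq_bigr => i _.
rewrite /mask_sum (clin_word_sum _ _ (@clin_proj _ _ _)) szf -word_sumE; apply: eq_bigr => b _.
by rewrite (clinZ _ _ (@clin_proj _ _ _)).
Qed.

End Jacobi.

(** * The Schouten square of Gamma and the equivalence *)

Section SchoutenSquare.
Variables (K : fieldType) (m : nat) (edeg : 'I_m -> int).
Notation T := (polyvec K edeg).
Notation O := (functionsV K edeg).
Implicit Types (A B : T).

Lemma schouten_even A B : parhom false A -> parhom false B ->
  schouten A B = graded_comm false false A B.
Proof.
move=> hA hB; rewrite /schouten /graded_comm !big_bool !(parity_part_hom _ hA) !(parity_part_hom _ hB) /=.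
have z X : bullet 0 X = 0 :> T by exact: (clin0 (clin_bulletl X)).
have z' X : bullet X 0 = 0 :> T by exact: (clin0 (clin_bulletr X)).
by rewrite !z !z' !scaler0 !add0r expr0 expr1 scale1r scaleN1r opprK.
Qed.

Variable Gamma : nat -> T.
Hypothesis Gamma_par : forall k, parhom false (Gamma k).

(** For even fields the bracket is A . B + B . A, and the substitution of k - i for i exchanges the
    two halves of the convolution; hence the factor 2. *)
Lemma acts_hschouten bs fs k : parhoms bs fs ->
  acts fs (hschouten Gamma Gamma k) =
  (2%:R : K) *: \sum_(i < k.+1) mask_sum fs bs false (Gamma i) (Gamma (k - i)%N).
Proof.
move=> h; rewrite /hschouten (clin_lsum _ _ _ (clin_acts fs)).
under eq_bigr => i _.
  rewrite schouten_even // (acts_graded_comm h (@Gamma_par _) (@Gamma_par _)) /= expr1 scaleN1r opprK.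
  over.
rewrite big_split /= -[2%:R]/(1 + 1) scalerDl scale1r; congr (_ + _).
rewrite (reindex_inj rev_ord_inj); apply: eq_bigr => i _ /=.
by rewrite subSS subKn // -ltnS.
Qed.

(** Shows that the relations reach every coefficient: one of hbar^k with n factors psi has n >= k +
    1, so relation k + 2 in n arguments satisfies the bound k + 2 <= n + 1. *)
Lemma weight_ge_hschouten k : (forall i, weight_ge i.+1 (Gamma i)) ->
  weight_ge k.+1 (hschouten Gamma Gamma k).
Proof.
move=> h; apply: weight_ge_sum => i; rewrite schouten_even // /graded_comm /= expr1 scaleN1r opprK.
have ik : (i <= k)%N by rewrite -ltnS.
apply: weight_geD.
  apply: weight_geW (weight_ge_bullet (h i) (h (k - i)%N)); lia.
apply: weight_geW (weight_ge_bullet (h (k - i)%N) (h i)); lia.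
Qed.

End SchoutenSquare.

Theorem theorem6p4p1 (K : fieldType) (charK0 : [pchar K] =i pred0)
    (m : nat) (edeg : 'I_m -> int)
    (Gamma : nat -> polyvec K edeg)
    (Gamma_weight : forall k, weight_ge k.+1 (Gamma k))
    (G : nat -> seq 'I_m -> functionsV K edeg)
    (G_coefs : forall k, coefficients_of (Gamma k) (G k)) :
  (forall n k, (1 <= k <= n)%N -> graded_leibniz (Lbr G k) n) /\
  (is_L2infty (@homogeneous K m (tdeg edeg))
     (fun k fs => (-1) ^+ 'C(size fs, 2) *: Lbr G k fs)
   <->
   (forall k, homogeneous 2 (Gamma k)) /\
   (forall k, hschouten Gamma Gamma k = 0)).
Proof.
have chainG k a : proj (chain a (Gamma k)) = G k a by exact: coefficients_chain.
have two0 : (2%:R : K) != 0 by move/pcharf0P: charK0 => ->.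
have jacobiE n k dv (v : 'I_n -> functionsV K edeg) bs :
    (forall k, homogeneous 2 (Gamma k)) -> (forall i, homogeneous (dv i) (v i)) ->
    bs = [seq par (dv x) | x <- enum 'I_n] ->
    proj (acts [seq v x | x <- enum 'I_n] (hschouten Gamma Gamma k)) =
    (2%:R : K) *: proj (\sum_(i < k.+1)
       mask_sum [seq v x | x <- enum 'I_n] bs false (Gamma i) (Gamma (k - i)%N)).
  move=> hG hv ->; rewrite (@acts_hschouten _ _ _ _ _ [seq par (dv x) | x <- enum 'I_n]).
  - by rewrite (clinZ _ _ (@clin_proj _ _ _)).
  - by move=> i; exact: homogeneous_parhom (hG i).
  - by elim: (enum _) => //= x t ih; split=> //; apply: homogeneous_parhom.
split=> [n k _|]; first exact: (bracket_leibniz (chainG k.-1)).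
split=> [L|[hG hS]]; last first.
  split.
  - move=> k us vs c x y _; rewrite !size_cat /= /Lbr (bracket_linear (chainG k.-1)).
    by rewrite scalerDr !scalerA mulrC.
  - move=> k ds vs _ h; apply: homogeneousZ.
    exact: (homogeneous_bracket (chainG k.-1) h (hG _)).
  - move=> k ds es dx dy us vs x y _ hu hv hx hy; rewrite !size_cat /=.
    rewrite /Lbr (bracket_skew (chainG k.-1) (parhoms_homs hu) (parhoms_homs hv)
      (homogeneous_parhom hx) (homogeneous_parhom hy)).
    by rewrite sgz_par parM !scalerA mulrC.
  - move=> n [|[|k]] // _ _ dv v hv.
    apply: etrans (jacobi_sum Gamma_weight chainG hG k hv) _.
    have := jacobiE n k dv v _ hG hv erefl.
    rewrite hS (clin0 (clin_acts _)) (clin0 (@clin_proj _ _ _)).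
    move/esym/eqP; rewrite scaler_eq0 (negbTE two0) /= => /eqP ->.
    by rewrite scaler0.
(* On coordinates the bracket is, up to sign, a coefficient of Gamma, of degree \sum |t^(a_i)| + 2 -
   n by [L2_degree]; the factors psi_(a_i) add n - \sum |t^(a_i)|. *)
have hG k : homogeneous 2 (Gamma k).
  move=> P nz; have [a [q [sz nq ->]]] := word_extract charK0 nz.
  have := L2_degree L (k := k.+1) _ (homs_gens K edeg a).
  rewrite size_map /Lbr (bracket_gens (chainG k)) => /(_ _ q) ->.
  + have -> : \sum_(c <- a) psideg edeg c = (size a)%:Z - \sum_(c <- a) tdeg edeg c.
      by rewrite /psideg sumrB big_const_seq count_predT iter_addr_0 natz.
    by rewrite big_map; ring.
  + by rewrite sz; exact: Gamma_weight nz.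
  + by rewrite !scalesE !mulf_neq0 // ?signr_eq0.
split=> // k; apply: serE => P; apply/eqP/negPn/negP => nz.
have [a [q [sz nq _]]] := word_extract charK0 nz.
have wk : (k.+1 <= size a)%N.
  rewrite sz; apply: (weight_ge_hschouten _ Gamma_weight nz) => i.
  exact: homogeneous_parhom (hG i).
pose t := in_tuple a.
have ea : [seq gen K (tdeg edeg) (tnth t x) | x <- enum 'I_(size a)] = map (gen K (tdeg edeg)) a.
  by rewrite (map_comp (gen K (tdeg edeg)) (tnth t)) map_tnth_enum.
have hv i : homogeneous (tdeg edeg (tnth t i)) (gen K (tdeg edeg) (tnth t i)).
  exact: homogeneous_gen.
have J : L2_relation (@homogeneous K m (tdeg edeg))
    (fun k fs => (-1) ^+ 'C(size fs, 2) *: Lbr G k fs) (size a) k.+2.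
  by apply: (L2_jacobi L); lia.
have := esym (jacobi_sum Gamma_weight chainG hG k hv).
rewrite [RHS](J _ _ hv) => /eqP; rewrite scaler_eq0 signr_eq0 /= => /eqP e.
move: nq; have := jacobiE _ k _ _ _ hG hv erefl.
by rewrite e scaler0 ea acts_gens => ->; rewrite zerosE eqxx.
Qed.
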